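(* For every $\epsilon > 0$ there is a constant $C_\epsilon > 0$ such that the following holds. Let $p > 3$ be a prime, let $a$ be an integer with $\gcd(a, p) = 1$, let $c$ be any integer, and let $H$ be a positive integer with $H \ge C_\epsilon\, p^{1/6 + \epsilon}$. Let $C_{a,c} := \{(x, y) \in (\mathbb{Z}/p\mathbb{Z})^2 : y \equiv a x^3 + c x \pmod p\}$, and for integers $X, Y$ let $B(X, Y; H) := \{(x, y) \in (\mathbb{Z}/p\mathbb{Z})^2 : x \equiv X + i \pmod p,\ y \equiv Y + j \pmod p \text{ for some integers } 1 \le i, j \le H\}$. Then there exist integers $0 \le X, Y \le p - 1$ such that $|C_{a,c} \cap B(X, Y; H)| \ge 2$.
   Context: The box $B(X,Y;H)$ is a square of side length $H$ taken with residues modulo $p$ (wrapping around), and $|S|$ denotes the number of elements of a set $S$. *)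

(* Defs.v *)
From mathcomp Require Import all_boot all_algebra.
From Stdlib Require Import Reals.
Set Implicit Arguments. Unset Strict Implicit. Unset Printing Implicit Defensive.
Import GRing.Theory.
Local Open Scope ring_scope.

(* Residues mod p are represented by 'I_p, i.e. the representatives 0..p-1;
   an integer z corresponds to the residue (z mod p). *)
Definition zres (p : nat) (z : int) : nat := absz (intdiv.modz z p%:Z).

Definition curveC (p : nat) (a c : int) : {set 'I_p * 'I_p} :=
  [set xy : 'I_p * 'I_p | (xy.2 : nat) == zres p (a * (xy.1 : nat)%:Z ^+ 3 + c * (xy.1 : nat)%:Z)].

Definition boxB (p : nat) (X Y : int) (H : nat) : {set 'I_p * 'I_p} :=
  [set xy : 'I_p * 'I_p | [exists i : 'I_H.+1, exists j : 'I_H.+1,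
     [&& leq 1 i, leq 1 j,
         (xy.1 : nat) == zres p (X + (i : nat)%:Z) &
         (xy.2 : nat) == zres p (Y + (j : nat)%:Z)]]].

(* Main.v *)
Require Import Defs.
From mathcomp Require Import all_boot all_order all_algebra finfield zify ring.
Set Implicit Arguments. Unset Strict Implicit. Unset Printing Implicit Defensive.
Import Order.TTheory GRing.Theory Num.Theory.
Local Open Scope ring_scope.

(** Write [f x = a x^3 + c x]. The points of abscissae [x - g] and [x + g] have
    ordinates differing by [6 a g x^2 + 2 f g], so if no box of side [H] contains
    two points then [3 a g (k - f g)] is a nonresidue for all small [g > 0] and
    [k]: the quadratic character is constant on an interval of length about [H]
    around each [f g], and the [f g] are [H]-separated.

    Dividing by a prime [u] in [(D, 2 D]], with [D = H p^(-o(1))], it is also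
    constant on the run of length [V = p^(o(1))] following each [(f g + k) / u],
    [g, k <= D]. By Stepanov's method and a second moment over products of [r]
    shifts, at most [O_r (sqrt p)] elements start such a run. On the other hand
    almost [D^3] of these quotients are distinct. A centre [f g] that is not
    [n / d] with [d <= D] and [n <= 4 D^2] gives quotients all different, and
    those of two such centres rarely meet. The centres that are such fractions
    have quotients which coincide modulo [p] only if they coincide as rational
    numbers, and [u] can be read off the denominator. Hence [D^3] is at most
    about [sqrt p], which is false for [H = p^(1/6 + eps)]. *)

(** * Stepanov's method *)

(** If the multiplicity [m] of [x] in [P] were at most [l], it would drop to exactly [m - 1] in the
    derivative, since [m] is nonzero in [F]. *)
Lemma dvdp_XsubC_deriv (F : fieldType) (P : {poly F}) (x : F) (l : nat) :
  (forall i, (0 < i <= l)%N -> i%:R != 0 :> F) ->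
  ('X - x%:P) ^+ l %| P^`() -> root P x -> ('X - x%:P) ^+ l.+1 %| P.
Proof.
move=> hl dP rP; have [->|P0] := eqVneq P 0; first by rewrite dvdp0.
have [m [q nrq eP]] := multiplicity_XsubC P x.
rewrite P0 /= in nrq.
have m0 : (0 < m)%N.
  by case: m eP => // eP; rewrite eP expr0 mulr1 in rP; rewrite rP in nrq.
case: (ltnP l m) => hm; first by rewrite eP dvdp_mull // dvdp_exp2l.
exfalso; move: dP; rewrite eP derivM deriv_exp derivXsubC mul1r => dP.
have dm : ('X - x%:P) ^+ m %| q^`() * ('X - x%:P) ^+ m
    + q * (('X - x%:P) ^+ m.-1 *+ m) by apply: dvdp_trans dP; rewrite dvdp_exp2l.
move: dm; rewrite dvdp_addr ?dvdp_mulIr // -mulr_natr mulrCA.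
rewrite -{1}(prednK m0) exprSr dvdp_mul2l ?expf_neq0 ?polyXsubC_eq0 //.
rewrite dvdp_XsubCl rootM (negPf nrq) /= rootE hornerMn hornerC.
by apply/negP/hl; rewrite m0.
Qed.

Lemma dvdp_XsubC_derivn (F : fieldType) (P : {poly F}) (x : F) (M : nat) :
  (forall i, (0 < i < M)%N -> i%:R != 0 :> F) ->
  (forall l, (l < M)%N -> root P^`(l) x) -> ('X - x%:P) ^+ M %| P.
Proof.
elim: M P => [|M IH] P hM hP; first by rewrite expr0 dvd1p.
apply: dvdp_XsubC_deriv => [i hi||]; first by apply: hM.
  apply: IH => [i /andP[i0 iM]|l lM]; first by apply: hM; rewrite i0 ltnS ltnW.
  by rewrite -derivSn; apply: hP.
exact: (hP 0%N).
Qed.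

Lemma dvdp_prod_XsubC_exp (F : fieldType) (P : {poly F}) (M : nat) (rs : seq F) :
  uniq rs -> (forall x, x \in rs -> ('X - x%:P) ^+ M %| P) ->
  \prod_(x <- rs) ('X - x%:P) ^+ M %| P.
Proof.
elim: rs => [|x rs IH]; first by rewrite big_nil dvd1p.
move=> /= /andP[xrs urs] h; rewrite big_cons Gauss_dvdp.
  by rewrite h ?mem_head //= IH // => y yrs; rewrite h // in_cons yrs orbT.
elim: rs xrs {IH urs h} => [|y rs IH]; first by rewrite big_nil coprimep1.
rewrite in_cons negb_or big_cons coprimepMr => /andP[xy /IH ->]; rewrite andbT.
apply/coprimep_expl/coprimep_expr; rewrite coprimep_XsubC root_XsubC.
by rewrite eq_sym.
Qed.

(** Pigeonhole on finitely many vectors stands in for a rank argument: two vectors with the same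
    image differ by a kernel vector. It provides the coefficients of Stepanov's auxiliary
    polynomial. *)
Lemma ffun_kernel (F : finNzRingType) (I K : finType)
    (phi : {ffun I -> F} -> {ffun K -> F}) :
  (forall u v, phi (u - v) = phi u - phi v) -> (#|K| < #|I|)%N ->
  exists2 v, v != 0 & phi v = 0.
Proof.
move=> phiB ltKI.
have : ~ injective phi.
  move=> /leq_card; rewrite !card_ffun leqNgt ltn_exp2l ?ltKI //.
  exact: finNzRing_gt1.
move=> /injectiveP; rewrite /injectiveb => /dinjectivePn[u _ [v]].
rewrite inE => /andP[vu _] e; exists (v - u); first by rewrite subr_eq0.
by rewrite phiB e subrr.
Qed.

Section StepanovAuxiliary.

Variables (F : fieldType) (f : {poly F}).

Definition twisted_deriv (k : nat) (r : {poly F}) : {poly F} :=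
  f^`() * r *+ k + f * r^`().

(* [f ^+ k * r] has [l]-th derivative [f ^+ (k - l) * twisted_derivn k l r];
   the same recursion with [k = M + e] absorbs the factor [f ^+ e]. *)
Fixpoint twisted_derivn (k l : nat) (r : {poly F}) : {poly F} :=
  if l is l'.+1 then twisted_deriv (k - l') (twisted_derivn k l' r) else r.

Lemma twisted_derivnB k l (r1 r2 : {poly F}) :
  twisted_derivn k l (r1 - r2) = twisted_derivn k l r1 - twisted_derivn k l r2.
Proof.
by elim: l => //= l ->; rewrite /twisted_deriv derivB !mulrBr mulrnBl; ring.
Qed.

Lemma size_twisted_derivn k l (r : {poly F}) A : (size r <= A)%N ->
  (size (twisted_derivn k l r) <= A + l * (size f).-1)%N.
Proof.
move=> rA; elim: l => [|l IH] /=; first by rewrite addn0.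
have [->|r0] := eqVneq (twisted_derivn k l r) 0.
  by rewrite /twisted_deriv mulr0 mul0rn deriv0 mulr0 addr0 size_poly0.
have h := IH; rewrite /twisted_deriv.
have [->|f0] := eqVneq f 0.
  by rewrite deriv0 !mul0r mul0rn addr0 size_poly0.
have sf' : (size f^`() <= (size f).-1)%N by rewrite -ltnS prednK ?lt_size_deriv ?size_poly_gt0.
have sr' : (size (twisted_derivn k l r)^`() <= (size (twisted_derivn k l r)).-1)%N.
  by rewrite -ltnS prednK ?lt_size_deriv ?size_poly_gt0.
apply: leq_trans (size_polyD _ _) _; rewrite geq_max.
have f1 : (0 < size f)%N by rewrite size_poly_gt0.
have r1 : (0 < size (twisted_derivn k l r))%N by rewrite size_poly_gt0.
rewrite mulSn; move: h sf' sr' f1 r1; set tr := twisted_derivn k l r => h sf' sr' f1 r1.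
apply/andP; split; last first.
  apply: leq_trans (size_polyMleq _ _) _.
  by move: (size f) (size tr) (size tr^`()) h sf' sr' f1 r1 => b c d; nia.
apply: leq_trans (_ : (size (f^`() * tr)%R <= _)%N); last first.
  apply: leq_trans (size_polyMleq _ _) _.
  by move: (size f) (size tr) (size f^`()) h sf' sr' f1 r1 => b c d; nia.
by rewrite -mulr_natr -polyC_natr mulrC mul_polyC size_scale_leq.
Qed.

Variable p : nat.
Hypothesis pcharF : p \in [pchar F].

Lemma deriv_Xn_pchar j : ('X^(p * j) : {poly F})^`() = 0.
Proof.
rewrite derivXn -mulr_natr natrM mulrA -polyC_natr.
by rewrite (pcharf0 pcharF) polyC0 mulr0 mul0r.
Qed.

(** Closed form of the [l]-th derivative of [f^M * sum_j (r_j + s_j f^e) X^(p j)], in which each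
    [X^(p j)] behaves as a constant in characteristic [p]. *)
Definition stepanov_poly (e J M : nat) (r s : 'I_J -> {poly F}) (l : nat) :=
  f ^+ (M - l) * \sum_(j < J) (twisted_derivn M l (r j)
     + twisted_derivn (M + e) l (s j) * f ^+ e) * 'X^(p * j).

Lemma deriv_stepanov_poly e J M (r s : 'I_J -> {poly F}) l :
  (0 < e)%N -> (l < M)%N ->
  (stepanov_poly e M r s l)^`() = stepanov_poly e M r s l.+1.
Proof.
case: e => // e _ lM; rewrite /stepanov_poly !big_distrr /= linear_sum /=.
apply: eq_bigr => j _; rewrite !derivM deriv_Xn_pchar mulr0 addr0 mulrA.
rewrite mulrA [RHS]mulrA -mulrDl; congr (_ * _).
have -> : (M - l)%N = (M - l.+1).+1 by lia.
have -> : (M + e.+1 - l)%N = ((M - l.+1).+1 + e.+1)%N by lia.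
(* Here [fn] stands for [f ^+ (M - l.+1)] and [fe] for [f ^+ e]; the exponents were rewritten as
   successors so that differentiation lowers them without truncation. *)
have ringE (R : comNzRingType) (a b : nat) (fn fe P P' S S' g g' : R) :
    g' * fn *+ a * (P + S * (g * fe)) + g * fn * (P' + (S' * (g * fe) + S * (g' * fe *+ b)))
  = fn * (g' * P *+ a + g * P' + (g' * S *+ (a + b) + g * S') * (g * fe)) by ring.
rewrite derivD derivM !deriv_exp !succnK /twisted_deriv !(exprS f); exact: ringE.
Qed.

Lemma derivn_stepanov_poly e J M (r s : 'I_J -> {poly F}) l :
  (0 < e)%N -> (l <= M)%N ->
  (stepanov_poly e M r s 0)^`(l) = stepanov_poly e M r s l.
Proof.
move=> e0; elim: l => // l IH lM.
by rewrite derivnS IH ?deriv_stepanov_poly // ltnW.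
Qed.

End StepanovAuxiliary.

(* The lowest nonzero term of [R + f^e S = 0] gives [r^2 f = f(0)^p s^2]
   modulo ['X^p], hence exactly, against the parity of the multiplicity at [a]. *)
Lemma stepanov_independence (F : fieldType) (p e A J : nat) (f : {poly F}) (a : F)
    (r s : nat -> {poly F}) :
  p \in [pchar F] -> p = (e * 2).+1 -> f.[0] != 0 -> odd (mup a f) ->
  (0 < A)%N -> (A * 2 + size f <= p.+2)%N ->
  (forall j, (size (r j) <= A)%N) -> (forall j, (size (s j) <= A)%N) ->
  (exists2 j, (j < J)%N & (r j != 0) || (s j != 0)) ->
  \sum_(j < J) (r j + s j * f ^+ e) * 'X^(p * j) != 0.
Proof.
move=> pF pe f0 mf A0 hA hr hs [j jJ hj].
have exj : exists j, (j < J)%N && ((r j != 0) || (s j != 0)) by exists j; rewrite jJ.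
case: (ex_minnP exj) => {jJ hj exj}j /andP[jJ hj] minj.
apply/eqP => sum0.
have nzf : f != 0 by apply: contraNneq f0 => ->; rewrite horner0.
have p0 : (0 < p)%N by rewrite pe.
(* Terms before [j] vanish by minimality and later ones carry a further factor ['X^p]. *)
have dX : 'X^p %| r j + s j * f ^+ e.
  have : 'X^(p * j) * 'X^p %| 'X^(p * j) * (r j + s j * f ^+ e).
    rewrite -[X in _ %| X]subr0 -[X in _ %| _ - X]sum0 -exprD -mulnSr.
    rewrite (bigD1 (Ordinal jJ)) //= mulrC opprD addrA subrr add0r dvdpNr.
    apply: (big_ind (fun P => 'X^(p * j.+1) %| P)) => [|u v|i ij].
    - exact: dvdp0.
    - exact: dvdp_add.
    case: (ltngtP i j) => hij.
    - have : ~~ ((r i != 0) || (s i != 0)).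
        by apply/negP => h; have := minj i; rewrite h ltn_ord leqNgt hij => /(_ isT).
      rewrite negb_or !negbK => /andP[/eqP-> /eqP->].
      by rewrite mul0r addr0 mul0r dvdp0.
    - by rewrite dvdp_mull // dvdp_exp2l // leq_mul2l hij orbT.
    - by case/eqP: ij; apply: val_inj.
  by rewrite dvdp_mul2l // expf_neq0 ?polyX_eq0.
pose c : F := f.[0] ^+ p.
have dfp : 'X^p %| f ^+ p - c%:P.
  have -> : f ^+ p - c%:P = (f - (f.[0])%:P) ^+ p.
    have pP : p \in [pchar {poly F}] by rewrite pchar_poly.
    rewrite -!(pFrobenius_autE pP) pFrobenius_autB_comm; last exact: mulrC.
    by rewrite /c polyC_exp !pFrobenius_autE.
  rewrite dvdp_exp2r // -[X in X %| _]subr0 -polyC0 dvdp_XsubCl rootE.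
  by rewrite hornerD hornerN hornerC subrr.
have e1 : r j ^+ 2 * f = c *: s j ^+ 2.
  apply/eqP; rewrite -subr_eq0; apply/negPn/negP => nz.
  have d : 'X^p %| r j ^+ 2 * f - c *: s j ^+ 2.
    have -> : r j ^+ 2 * f - c *: s j ^+ 2 =
       (r j + s j * f ^+ e) * ((r j - s j * f ^+ e) * f) + s j ^+ 2 * (f ^+ p - c%:P).
      rewrite -mul_polyC pe (exprS f) (exprM f); ring.
    by apply: dvdp_add; [exact: dvdp_mulr|exact: dvdp_mull].
  (* Divisibility by ['X^p] forces a size above [p], whereas [A * 2 + size f <= p.+2] keeps it at
     most [p]. *)
  have := dvdp_leq nz d; rewrite size_polyXn.
  have h1 := size_polyMleq (r j ^+ 2) f; have h2 := size_polyMleq (r j) (r j).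
  have h3 := size_polyMleq (s j) (s j).
  have h4 : (size (c *: s j ^+ 2) <= size (s j ^+ 2))%N by apply: size_scale_leq.
  have h5 := size_polyD (r j ^+ 2 * f) (- (c *: s j ^+ 2)).
  rewrite size_polyN in h5; rewrite -!expr2 in h2 h3.
  have f1 : (1 < size f)%N.
    rewrite ltnNge; apply/negP => /size1_polyC fc; move: mf; rewrite fc mupNroot //.
    by rewrite rootE hornerC; apply: contraNneq nzf => f00; rewrite fc f00.
  have := hr j; have := hs j; move: h5 h1 h2 h3 h4 hA f1.
  move: (size (r j ^+ 2 * f - _)) (size (r j ^+ 2 * f)) (size (c *: s j ^+ 2)) => z1 z2 z3.
  move: (size (r j ^+ 2)) (size (s j ^+ 2)) (size f) (size (r j)) (size (s j)).
  lia.
have c0 : c != 0 by rewrite expf_neq0.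
have rs0 : (r j != 0) && (s j != 0).
  have [r0|r0] := eqVneq (r j) 0; last first.
    apply/eqP => s0; move/eqP: e1; rewrite s0 expr0n scaler0 mulf_eq0 sqrf_eq0.
    by rewrite (negPf r0) (negPf nzf).
  move: e1 hj; rewrite r0 expr0n mul0r => /esym/eqP.
  by rewrite eqxx scaler_eq0 (negPf c0) /= sqrf_eq0 => ->.
case/andP: rs0 => r0 s0; have := congr1 (fun P => odd (mup a P)) e1.
rewrite -mul_polyC !expr2 !mupM ?mulf_neq0 ?polyC_eq0 // !oddD !addbb mf.
by rewrite mupNroot // rootC.
Qed.

Lemma natf_neq0_Fp (p i : nat) : prime p -> (0 < i < p)%N -> i%:R != 0 :> 'F_p.
Proof.
move=> pp /andP[i0 ip]; rewrite -(dvdn_pcharf (pchar_Fp pp)).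
by rewrite gtnNdvd.
Qed.

Lemma expFp (p : nat) (x : 'F_p) : prime p -> x ^+ p = x.
Proof. by move=> pp; rewrite -[in X in x ^+ X](card_Fp pp) expf_card. Qed.

(** A nonzero auxiliary polynomial of degree [p * (m + O(s))] vanishes to order [2 * m] at each
    point counted. As [m] is of order [sqrt p], this leaves at most [p / 2 + O(s * m)] points. *)
Lemma stepanov_count (p e m s : nat) (f : {poly 'F_p}) (a : 'F_p) :
  prime p -> p = (e * 2).+1 -> size f = s.+1 -> (0 < s)%N ->
  f.[0] != 0 -> odd (mup a f) ->
  (1 < m)%N -> (4 * m ^ 2 <= p)%N -> (p <= 16 * m ^ 2)%N -> (4 * s.+1 <= p)%N ->
  (2 * #|[set x | (f.[x] ^+ e == 1)%R]| <= p + 2 * s + 8 * m * (5 * s + 3))%N.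
Proof.
move=> pp pe sf s0 f0 mf m1 mp pm sp.
(* [A] is nearly the largest size that [stepanov_independence] allows. The [2 * A * J] unknowns must
   outnumber the [M * B] equations: the part [m = M / 2] of [J] balances the term [A] of [B], and
   the surplus [2 * s + 2] pays for the rest. *)
pose A := ((p - s) %/ 2)%N; pose J := (m + (2 * s + 2))%N; pose M := (2 * m)%N.
pose B := (A + J + M * s)%N.
have pF := pchar_Fp pp.
have nzf : f != 0 by rewrite -size_poly_gt0 sf.
have e0 : (0 < e)%N by case: (e) pe pp => // ->.
have A0 : (0 < A)%N by rewrite divn_gt0 //; lia.
pose rr b (v : {ffun bool * 'I_J * 'I_A -> 'F_p}) (j : 'I_J) : {poly 'F_p} :=
  \sum_(i < A) v (b, j, i) *: 'X^i.
have size_rr b v j : (size (rr b v j) <= A)%N.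
  apply: leq_trans (size_sum _ _ _) _; apply/bigmax_leqP => i _.
  by apply: leq_trans (size_scale_leq _ _) _; rewrite size_polyXn.
have rrB b u v j : rr b (u - v) j = rr b u j - rr b v j.
  by rewrite /rr -sumrB; apply: eq_bigr => i _; rewrite !ffunE scalerBl.
(* This is the [l]-th derivative without its factor [f ^+ (M - l)], with [f ^+ e] replaced by [1]
   and ['X^p] by ['X]. Values at the counted points are unchanged, but the degree is now small, so
   that its vanishing costs few equations. *)
pose cond (v : {ffun bool * 'I_J * 'I_A -> 'F_p}) (l : nat) : {poly 'F_p} :=
  \sum_(j < J) (twisted_derivn f M l (rr true v j)
     + twisted_derivn f (M + e) l (rr false v j)) * 'X^j.
have condB u v l : cond (u - v) l = cond u l - cond v l.
  rewrite /cond -sumrB; apply: eq_bigr => i _.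
  by rewrite !rrB !twisted_derivnB; ring.
have size_cond v l : (l < M)%N -> (size (cond v l) <= B)%N.
  move=> lM; apply: leq_trans (size_sum _ _ _) _; apply/bigmax_leqP => j _.
  apply: leq_trans (size_polyMleq _ _) _; rewrite size_polyXn addnS /=.
  have hT k b : (size (twisted_derivn f k l (rr b v j)) <= A + M * s)%N.
    apply: leq_trans (size_twisted_derivn f k l (size_rr b v j)) _.
    by rewrite sf /= leq_add2l leq_mul2r (ltnW lM) orbT.
  have := size_polyD (twisted_derivn f M l (rr true v j))
     (twisted_derivn f (M + e) l (rr false v j)).
  have := hT M true; have := hT (M + e)%N false; have := ltn_ord j; rewrite /B.
  move: (size _) (size _) (size _) => x y z; lia.
pose phi v : {ffun 'I_M * 'I_B -> 'F_p} := [ffun li : 'I_M * 'I_B => (cond v li.1)`_li.2].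
have [||v nzv phiv] := @ffun_kernel 'F_p _ _ phi.
- by move=> u v; apply/ffunP => li; rewrite !ffunE condB coefB.
- rewrite !card_prod card_bool !card_ord.
  have hA : (p - s - 1 <= 2 * A)%N by rewrite /A; lia.
  rewrite /B /J /M; nia.
have cond0 l : (l < M)%N -> cond v l = 0.
  move=> lM; apply/polyP => k; rewrite coef0; case: (ltnP k B) => kB.
    by have /ffunP/(_ (Ordinal lM, Ordinal kB)) := phiv; rewrite !ffunE.
  by rewrite nth_default // (leq_trans (size_cond _ _ lM)).
pose Psi := stepanov_poly f p e M (rr true v) (rr false v) 0.
have rootPsi x l : f.[x] ^+ e = 1 -> (l < M)%N -> root Psi^`(l) x.
  move=> gx lM; rewrite derivn_stepanov_poly // ?(ltnW lM) //.
  rewrite rootE /stepanov_poly hornerM (_ : (\sum_(j < J) _).[x] = (cond v l).[x]).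
    by rewrite cond0 // horner0 mulr0.
  rewrite /cond !horner_sum; apply: eq_bigr => j _.
  by rewrite !(hornerM, hornerD, hornerXn, horner_exp) gx mulr1 exprM expFp.
have dPsi : \prod_(x <- enum [set x | f.[x] ^+ e == 1]) ('X - x%:P) ^+ M %| Psi.
  apply: dvdp_prod_XsubC_exp; first exact: enum_uniq.
  move=> x; rewrite mem_enum inE => /eqP gx.
  apply: dvdp_XsubC_derivn => [i /andP[i0 iM]|l lM]; last exact: rootPsi.
  apply: natf_neq0_Fp => //; rewrite i0 (leq_trans iM) // /M; nia.
(* Extension by zero to all natural indices, the form used in [stepanov_independence]. *)
pose nr b (j : nat) : {poly 'F_p} := if insub j is Some j' then rr b v j' else 0.
have nrE b (j : 'I_J) : nr b j = rr b v j.
  by rewrite /nr insubT //= => h; congr (rr b v _); apply: val_inj.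
have nzPsi : Psi != 0.
  rewrite mulf_neq0 ?expf_neq0 //= (eq_bigr (fun j : 'I_J =>
     (nr true j + nr false j * f ^+ e) * 'X^(p * j))); last first.
    by move=> j _; rewrite !nrE.
  apply: (stepanov_independence pF pe f0 mf A0) => [|j|j|].
  - by rewrite sf /A; lia.
  - by rewrite /nr; case: insubP => [j' _ _|_]; rewrite ?size_rr ?size_poly0.
  - by rewrite /nr; case: insubP => [j' _ _|_]; rewrite ?size_rr ?size_poly0.
  have [[[b j] i] nz] : exists bji, v bji != 0.
    apply/existsP; apply: contraNT nzv => /existsPn h.
    by apply/eqP/ffunP => bji; rewrite ffunE; apply/eqP/negbNE/h.
  exists j => //; rewrite !nrE.
  have : rr b v j != 0.
    apply: contraNneq nz => /(congr1 (fun P : {poly _} => P`_i)).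
    rewrite coef0 coef_sum (bigD1 i) //= coefZ coefXn eqxx mulr1 big1 ?addr0 => [->//|k ki].
    by rewrite coefZ coefXn eq_sym (inj_eq val_inj) (negPf ki) mulr0.
  by case: (b) => ->; rewrite ?orbT.
have := dvdp_leq nzPsi dPsi; set N := #|_|.
rewrite prodrXl.
have -> : size ((\prod_(x <- enum [set x | f.[x] ^+ e == 1]) ('X - x%:P)) ^+ M)
    = (N * M).+1.
  rewrite -[LHS]prednK ?size_poly_gt0 ?expf_neq0 ?monic_neq0 ?monic_prod_XsubC //.
  by rewrite size_exp size_prod_XsubC -cardE.
have sfM k : size (f ^+ k) = (s * k).+1.
  by rewrite -[LHS]prednK ?size_poly_gt0 ?expf_neq0 // size_exp sf.
have sPsi : (size Psi <= s * M + (A + s * e + p * (J - 1)))%N.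
  rewrite /Psi /stepanov_poly subn0; apply: leq_trans (size_polyMleq _ _) _.
  rewrite sfM /= leq_add2l.
  apply: leq_trans (size_sum _ _ _) _; apply/bigmax_leqP => j _.
  apply: leq_trans (size_polyMleq _ _) _; rewrite size_polyXn addnS /=.
  apply: leq_add; last by rewrite leq_mul2l; have := ltn_ord j; lia.
  apply: leq_trans (size_polyD _ _) _; rewrite geq_max.
  rewrite (leq_trans (size_rr _ _ _)) ?leq_addr //=.
  apply: leq_trans (size_polyMleq _ _) _; rewrite sfM addnS /=.
  by rewrite leq_add2r.
have hA : (2 * A <= p)%N by rewrite /A; lia.
move=> h; have {h} : (N * M < s * M + (A + s * e + p * (J - 1)))%N.
  exact: leq_trans h sPsi.
rewrite /M (_ : J - 1 = m + (2 * s + 1))%N; last by rewrite /J; lia.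
move: hA sp mp pm m1 s0; rewrite {pF}; clear -pe; move: N A => N A *.
(* One factor [p] is traded for [16 * m ^ 2], after which [m] cancels. *)
have h1 : (4 * (N * m) <= 4 * (s * m) + 2 * (p * m) + p * (5 * s + 3))%N by nia.
have h2 : (p * (5 * s + 3) <= 16 * m ^ 2 * (5 * s + 3))%N by rewrite leq_mul2r; lia.
have h3 : (m * (4 * N) <= m * (4 * s + 2 * p + 16 * m * (5 * s + 3)))%N by nia.
by rewrite leq_pmul2l in h3; lia.
Qed.

(** * Long runs of constant quadratic character *)

Lemma sumr_pred (T : finType) (P : pred T) :
  \sum_x (P x)%:R = #|[set x | P x]|%:R :> int.
Proof.
rewrite -sum1_card natr_sum [RHS]big_mkcond /=.
by apply: eq_bigr => x _; rewrite inE; case: (P x).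
Qed.

Section QuadraticCharacter.

Variables (p : nat).
Hypotheses (pp : prime p) (p2 : (2 < p)%N).

(** The Legendre symbol through Euler's criterion, integer valued so that its sums can be
    compared. *)
Definition qchar (x : 'F_p) : int :=
  if x == 0 then 0 else if x ^+ p./2 == 1 then 1 else -1.

Lemma odd_half_prime : p = (p./2 * 2).+1.
Proof.
have [e2|op] := even_prime pp; first by move: p2; rewrite e2.
by rewrite muln2 -[LHS]odd_double_half op.
Qed.

Lemma exp_half (x : 'F_p) : x != 0 -> (x ^+ p./2 == 1) || (x ^+ p./2 == -1).
Proof.
move=> x0; rewrite -sqrf_eq1 -exprM; apply/eqP/(mulfI x0).
by rewrite mulr1 -exprS -odd_half_prime expFp.
Qed.

Lemma oppr1_neq1 : (-1 : 'F_p) != 1.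
Proof.
rewrite eq_sym -subr_eq0 opprK -[1 + 1]/(2%:R).
exact: natf_neq0_Fp.
Qed.

Lemma qchar0 : qchar 0 = 0.
Proof. by rewrite /qchar eqxx. Qed.

Lemma qcharM x y : qchar (x * y) = qchar x * qchar y.
Proof.
rewrite /qchar mulf_eq0; have [//|x0] := eqVneq x 0; first by rewrite mul0r.
have [//|y0] := eqVneq y 0; first by rewrite mulr0.
rewrite exprMn /=; have /orP[] := exp_half x0; have /orP[] := exp_half y0;
  by move=> /eqP-> /eqP->; rewrite ?mulr1 ?mul1r ?mulrNN ?eqxx ?mulr1 ?(negPf oppr1_neq1).
Qed.

Lemma qchar1 : qchar 1 = 1.
Proof. by rewrite /qchar oner_eq0 expr1n eqxx. Qed.

Lemma qchar_prod (I : Type) (s : seq I) (P : pred I) (E : I -> 'F_p) :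
  qchar (\prod_(i <- s | P i) E i) = \prod_(i <- s | P i) qchar (E i).
Proof. exact: (big_morph qchar qcharM qchar1). Qed.

Lemma qchar_sqr x : qchar x ^+ 2 = (x != 0)%:R.
Proof. by rewrite /qchar; case: ifP => // _; case: ifP. Qed.

(** Summed over [x], this turns a character sum into twice the count of Stepanov's method, less [p],
    plus the number of zeros. *)
Lemma qcharE x : qchar x = (x ^+ p./2 == 1)%:R *+ 2 - 1 + (x == 0)%:R.
Proof.
rewrite /qchar; case: eqP => [->|_]; last by case: ifP.
by rewrite expr0n eqn0Ngt half_gt0 (ltnW p2) eq_sym oner_eq0.
Qed.

Lemma qchar_ge x : -1 <= qchar x.
Proof. by rewrite /qchar; case: ifP => // _; case: ifP. Qed.

Variables (m V : nat).
Hypotheses (m1 : (1 < m)%N) (mp : (4 * m ^ 2 <= p)%N) (pm : (p <= 16 * m ^ 2)%N).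
Hypothesis Vp : (V < p)%N.

(** Shifts start at [1], so that with [V < p] the product is nonzero at [0], as [stepanov_count]
    requires. *)
Definition shift_prod (T : {set 'I_V}) (x : 'F_p) : 'F_p :=
  \prod_(i in T) (x + i.+1%:R).

Lemma shift_inj (i j : 'I_V) : i.+1%:R = j.+1%:R :> 'F_p -> i = j.
Proof.
move=> /(congr1 val); rewrite /= !(val_Fp_nat pp) !modn_small.
- by move=> [] /val_inj.
- exact: leq_ltn_trans (ltn_ord j) Vp.
- exact: leq_ltn_trans (ltn_ord i) Vp.
Qed.

Lemma shift_neq0 (i : 'I_V) : i.+1%:R != 0 :> 'F_p.
Proof. by apply: natf_neq0_Fp => //=; apply: leq_ltn_trans (ltn_ord i) Vp. Qed.

Lemma card_shift_prod_eq0 (T : {set 'I_V}) :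
  (#|[set x | shift_prod T x == 0%R]| <= #|T|)%N.
Proof.
have -> : [set x | shift_prod T x == 0] = [set - (i.+1%:R) | i : 'I_V in T].
  apply/setP => x; rewrite inE; apply/prodf_eq0/imsetP => -[i iT h]; exists i => //.
    by apply/eqP; rewrite -addr_eq0.
  by rewrite h addNr.
exact: leq_imset_card.
Qed.

(** Any element of [T] gives a simple root, because [V < p] keeps the shifts distinct; this is the
    odd multiplicity that [stepanov_count] asks for. An upper bound is enough for the second
    moment. *)
Lemma qchar_shift_prod_sum (T : {set 'I_V}) : T != set0 -> (4 * #|T|.+1 <= p)%N ->
  \sum_x qchar (shift_prod T x) <= (3 * #|T| + 8 * m * (5 * #|T| + 3))%:R.
Proof.
move=> T0 Tp; have /set0Pn[a aT] := T0.
pose f : {poly 'F_p} := \prod_(i in T) ('X - (- i.+1%:R)%:P).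
have fx x : f.[x] = shift_prod T x.
  by rewrite horner_prod; apply: eq_bigr => i _; rewrite !hornerE opprK.
have sf : size f = #|T|.+1.
  by rewrite /f -big_enum size_prod_XsubC -cardE.
have f0 : f.[0] != 0.
  by rewrite fx; apply/prodf_neq0 => i _; rewrite add0r shift_neq0.
have mf : odd (mup (- a.+1%:R) f).
  rewrite /f (bigD1 a) //= mupMl.
    by rewrite -['X - _]expr1 mup_XsubCX eqxx.
  rewrite rootE horner_prod; apply/prodf_neq0 => i /andP[_ ia].
  rewrite !hornerE opprK addrC subr_eq0; apply: contra ia => /eqP/shift_inj ->.
  exact: eqxx.
have T1 : (0 < #|T|)%N by rewrite card_gt0.
have := stepanov_count pp odd_half_prime sf T1 f0 mf m1 mp pm Tp.
set N := #|_| => hN.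
rewrite (eq_bigr (fun x => (f.[x] ^+ p./2 == 1)%:R *+ 2 - 1
   + (shift_prod T x == 0)%:R)) => [|x _]; last by rewrite qcharE fx.
rewrite big_split /= sumrB sumr_const card_Fp // sumrMnl !sumr_pred.
have := card_shift_prod_eq0 T; move: #|[set x | _ == 0]| => Z hZ.
rewrite -/N -[_ *+ 2]mulr_natr !natz; clearbody N; move: hN hZ.
move: (8 * m * (5 * #|T| + 3))%N => K; move: #|T| => t hN hZ. lia.
Qed.


(** The factors common to [I] and [J] contribute a square, so only the symmetric difference matters;
    it is nonempty and has at most [2 * r] elements. *)
Lemma qchar_shift_prod_pair_sum (r : nat) (I J : {set 'I_V}) : I != J ->
  (#|I| <= r)%N -> (#|J| <= r)%N -> (4 * (2 * r).+1 <= p)%N ->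
  \sum_x qchar (shift_prod I x) * qchar (shift_prod J x)
    <= (7 * r + 8 * m * (10 * r + 3))%:R.
Proof.
move=> IJ Ir Jr rp; pose T := (I :\: J) :|: (J :\: I).
have T0 : T != set0.
  apply: contra IJ; rewrite setU_eq0 !setD_eq0 => /andP[h1 h2].
  by rewrite eqEsubset h1.
have Tr : (#|T| <= 2 * r)%N.
  apply: leq_trans (leq_card_setU _ _) _; rewrite mul2n -addnn leq_add //.
    by apply: leq_trans (subset_leq_card (subsetDl _ _)) _.
  by apply: leq_trans (subset_leq_card (subsetDl _ _)) _.
(* At a zero of the common part the left side is [0] while the character on the right is at least
   [-1], whence the correction term. *)
have IE x : qchar (shift_prod I x) * qchar (shift_prod J x)
    <= qchar (shift_prod T x) + (shift_prod (I :&: J) x == 0)%:R.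
  have -> : shift_prod I x = shift_prod (I :&: J) x * shift_prod (I :\: J) x.
    by rewrite /shift_prod [LHS](big_setID J).
  have -> : shift_prod J x = shift_prod (I :&: J) x * shift_prod (J :\: I) x.
    by rewrite /shift_prod [LHS](big_setID I) setIC.
  have -> : shift_prod T x = shift_prod (I :\: J) x * shift_prod (J :\: I) x.
    rewrite /shift_prod -bigU; first by apply: eq_bigl => i; rewrite !inE.
    rewrite -setI_eq0; apply/eqP/setP => i.
    by rewrite !inE; case: (i \in I); case: (i \in J).
  rewrite !qcharM mulrACA -expr2 qchar_sqr; have [_|_] := eqVneq _ 0.
    by rewrite mul0r -qcharM -lerBlDr sub0r qchar_ge.
  by rewrite mul1r addr0.
apply: le_trans (ler_sum _ (fun x _ => IE x)) _; rewrite big_split /=.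
have hT := qchar_shift_prod_sum T0 (leq_trans _ rp).
have hI : \sum_x (shift_prod (I :&: J) x == 0)%:R <= r%:R :> int.
  rewrite sumr_pred ler_nat (leq_trans (card_shift_prod_eq0 _)) //.
  by apply: leq_trans (subset_leq_card (subsetIl _ _)) _.
apply: le_trans (lerD (hT _) hI) _; first by lia.
rewrite -natrD ler_nat.
have : (8 * m * (5 * #|T| + 3) <= 8 * m * (10 * r + 3))%N by rewrite leq_mul2l; lia.
move: (8 * m * (5 * #|T| + 3))%N (8 * m * (10 * r + 3))%N #|T| Tr; lia.
Qed.

(** For [x] in [L] every product of [r] shifts has character [t ^+ r = 1], as [r] is even, so [W x]
    equals ['C(V, r)]. In the second moment of [W] the diagonal gives at most [p * 'C(V, r)] and
    each other pair [O_r(m)]; since [p <= 16 * m ^ 2] and [m <= 'C(V, r)], the total is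
    [O_r(m * 'C(V, r) ^ 2)]. *)
Lemma constant_qchar_runs (r : nat) (L : {set 'F_p}) :
  ~~ odd r -> (m <= 'C(V, r))%N -> (4 * (2 * r).+1 <= p)%N ->
  (forall x, x \in L -> exists2 t : int, t ^+ 2 = 1 &
     forall i : 'I_V, qchar (x + i.+1%:R) = t) ->
  (#|L| <= m * (87 * r + 40))%N.
Proof.
move=> evr mC rp hL; pose D := [set I : {set 'I_V} | #|I| == r].
have cD : #|D| = 'C(V, r) by rewrite card_draws card_ord.
pose W x : int := \sum_(I in D) qchar (shift_prod I x).
have WL x : x \in L -> W x = #|D|%:R.
  move=> /hL[t t1 ht]; rewrite /W -sumr_const; apply: eq_bigr => I.
  rewrite inE => /eqP Ir; rewrite qchar_prod (eq_bigr (fun=> t)) // prodr_const Ir.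
  by rewrite -[r]odd_double_half (negPf evr) add0n -muln2 mulnC exprM t1 expr1n.
pose K := (7 * r + 8 * m * (10 * r + 3))%N.
have up : \sum_x W x ^+ 2 <= (#|D| * p + #|D| * #|D| * K)%:R.
  rewrite (eq_bigr (fun x => \sum_(I in D) \sum_(J in D)
      qchar (shift_prod I x) * qchar (shift_prod J x))); last first.
    by move=> x _; rewrite expr2 big_distrlr.
  rewrite exchange_big /= -mulnA -mulnDr natrM mulr_natl -sumr_const.
  apply: ler_sum => I ID.
  rewrite exchange_big (bigD1 I) //= natrD; apply: lerD.
    rewrite -[in X in _ <= X](card_Fp pp) -sumr_const; apply: ler_sum => x _.
    by rewrite -expr2 qchar_sqr; case: (_ != 0).
  rewrite natrM mulr_natl -sumr_const big_mkcondr /=; apply: ler_sum => J JD.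
  case: eqP => [_|/eqP JI] //=; apply: qchar_shift_prod_pair_sum => //.
  - by rewrite eq_sym.
  - by move: ID; rewrite inE => /eqP ->.
  - by move: JD; rewrite inE => /eqP ->.
have low : (#|L| * #|D| ^ 2)%:R <= \sum_x W x ^+ 2.
  rewrite (bigID (mem L)) /= -[X in X <= _]addr0; apply: lerD.
    rewrite natrM mulr_natl -sumr_const; apply: ler_sum => x xL.
    by rewrite WL // natrX.
  by apply: sumr_ge0 => x _; rewrite sqr_ge0.
have := le_trans low up; rewrite ler_nat cD => h.
have C0 : (0 < 'C(V, r))%N by apply: leq_trans mC; apply: ltnW.
have {}h : (#|L| * 'C(V, r) <= p + 'C(V, r) * K)%N.
  by rewrite -(leq_pmul2l C0); move: h; rewrite mulnDr; congr (_ <= _)%N; ring.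
have {}h : (#|L| * 'C(V, r) <= (16 * m + K) * 'C(V, r))%N.
  apply: leq_trans h _; rewrite mulnDl [(K * _)%N]mulnC leq_add2r.
  by apply: leq_trans pm _; rewrite -mulnA leq_mul2l -mulnn leq_mul2l mC orbT.
move: h; rewrite leq_pmul2r // => /leq_trans; apply; rewrite /K; nia.
Qed.

End QuadraticCharacter.

(** * Primes in dyadic intervals *)

(** By Legendre's formula the exponent is a sum over [k] of differences between the quotient of
    [2 m] by [q ^ k] and twice that of [m]. Each is at most [1], and is [0] once [q ^ k > 2 m]. *)
Lemma logn_central_bin (q m : nat) : prime q ->
  (logn q 'C(m.*2, m) <= trunc_log q m.*2)%N.
Proof.
move=> qp; have q1 := prime_gt1 qp.
have le_m : (m <= m.*2)%N by rewrite -addnn leq_addr.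
have b0 : (0 < 'C(m.*2, m))%N by rewrite bin_gt0.
have := congr1 (logn q) (bin_fact le_m).
have -> : (m.*2 - m = m)%N by rewrite -addnn addnK.
rewrite !lognM ?muln_gt0 ?fact_gt0 // !logn_fact // => e.
have sm : (\sum_(1 <= k < m.+1) m %/ q ^ k = \sum_(1 <= k < m.*2.+1) m %/ q ^ k)%N.
  have tail0 : (\sum_(m.+1 <= k < m.*2.+1) m %/ q ^ k = 0)%N; last first.
    by rewrite [RHS](@big_cat_nat _ _ _ m.+1) ?ltnS //= tail0 addn0.
  rewrite big_nat big1 // => k /andP[mk _]; apply: divn_small; apply: leq_trans mk _.
  exact: ltnW (ltn_expl _ q1).
have le2 : (\sum_(1 <= k < m.*2.+1) m.*2 %/ q ^ k <=
    \sum_(1 <= k < m.*2.+1) (m %/ q ^ k + m %/ q ^ k + (q ^ k <= m.*2)))%N.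
  apply: leq_sum => k _; have q0 : (0 < q ^ k)%N by rewrite expn_gt0 (ltnW q1).
  case: (leqP (q ^ k) m.*2) => h; last by rewrite divn_small.
  rewrite -ltnS ltn_divLR //.
  have := divn_eq m (q ^ k); have := ltn_pmod m q0.
  move: (m %/ q ^ k)%N (m %% q ^ k)%N => a b; rewrite -muln2.
  by move: (q ^ k)%N h q0 => c; nia.
have le3 : (\sum_(1 <= k < m.*2.+1) (q ^ k <= m.*2) <= trunc_log q m.*2)%N.
  rewrite -big_mkcond /= sum1_count; set t := trunc_log _ _.
  rewrite -size_filter -[X in (_ <= X)%N](size_iota 1 t).
  apply: uniq_leq_size; first by rewrite filter_uniq ?iota_uniq.
  move=> k; rewrite mem_filter mem_index_iota mem_iota => /andP[h /andP[-> _]] /=.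
  by rewrite add1n ltnS; apply: trunc_log_max.
move: e le2; rewrite !big_split /= -sm; lia.
Qed.

Lemma leq_central_bin (m : nat) : (2 ^ m <= 'C(m.*2, m))%N.
Proof.
elim: m => // m IH; rewrite doubleS binS.
have -> : ('C(m.*2.+1, m.+1) = 'C(m.*2.+1, m))%N.
  by rewrite -bin_sub -addnn; [congr ('C(_, _)); lia|lia].
rewrite addnn -mul2n expnS leq_mul2l /=; apply: leq_trans IH _.
by case: m => // m; rewrite [X in (_ <= X)%N]binS leq_addr.
Qed.

(** Each prime power exactly dividing the binomial coefficient is at most [2 m], and no prime above
    [2 m] occurs. *)
Lemma central_bin_leq (m : nat) : (0 < m)%N ->
  ('C(m.*2, m) <= m.*2 ^ size [seq q <- index_iota 2 m.*2.+1 | prime q])%N.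
Proof.
move=> m0; set C := 'C(_, _); set U := [seq _ <- _ | _].
have C0 : (0 < C)%N by rewrite bin_gt0 -addnn leq_addr.
rewrite -{1}(partnT C0) /partn.
have le1 : (\prod_(0 <= q < C.+1 | q \in predT) q ^ logn q C <=
   \prod_(0 <= q < C.+1) (if q \in U then m.*2 else 1))%N.
  apply: leq_prod => q _; rewrite mem_filter mem_index_iota ltnS.
  case: (boolP (prime q)) => [qp|qp]; last by rewrite lognE (negPf qp).
  rewrite prime_gt1 //=; case: (leqP q m.*2) => qm.
    apply: leq_trans (_ : q ^ trunc_log q m.*2 <= _)%N.
      by rewrite leq_exp2l ?prime_gt1 // logn_central_bin.
    by apply: trunc_logP; rewrite ?prime_gt1 // double_gt0.
  have := logn_central_bin m qp.
  have /eqP -> : trunc_log q m.*2 == 0%N by rewrite trunc_log_eq0; lia.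
  by rewrite leqn0 => /eqP ->.
apply: leq_trans le1 _; rewrite -big_mkcond /= big_const_seq iter_muln_1.
rewrite leq_exp2l ?ltn_double // -?muln2; last by lia.
rewrite -size_filter; apply: uniq_leq_size; first by rewrite filter_uniq ?iota_uniq.
by move=> q; rewrite mem_filter => /andP[].
Qed.

(** Chebyshev's argument gives at least [2 ^ n.-1 / n] primes up to [2 ^ n]; one of the [n] dyadic
    intervals holds the average share. *)
Lemma dyadic_primes (n : nat) : (0 < n)%N ->
  exists2 i, (i < n)%N &
    (2 ^ n <= 2 * n ^ 2 * size [seq q <- index_iota (2 ^ i).+1 (2 ^ i.+1).+1 | prime q])%N.
Proof.
move=> n0; pose U i := size [seq q <- index_iota (2 ^ i).+1 (2 ^ i.+1).+1 | prime q].
have sumU k : (\sum_(i < k) U i = size [seq q <- index_iota 2 (2 ^ k).+1 | prime q])%N.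
  elim: k => [|k IH]; first by rewrite big_ord0.
  rewrite big_ord_recr /= IH -size_cat -filter_cat; congr (size (filter _ _)).
  have := iotaD 2 (2 ^ k - 1) (2 ^ k).
  rewrite /index_iota expnS mul2n -addnn.
  have := expn_gt0 2 k; move: (2 ^ k)%N => t /= t0.
  have -> : (t.+1 - 2 = t - 1)%N by lia.
  have -> : ((t + t).+1 - 2 = t - 1 + t)%N by lia.
  have -> : ((t + t).+1 - t.+1 = t)%N by lia.
  have -> : (2 + (t - 1) = t.+1)%N by lia.
  by move=> ->.
have large : (2 ^ n.-1 <= n * \sum_(i < n) U i)%N.
  have h0 : (0 < 2 ^ n.-1)%N by rewrite expn_gt0.
  have := leq_trans (leq_central_bin (2 ^ n.-1)) (central_bin_leq h0).
  have -> : ((2 ^ n.-1).*2 = 2 ^ n)%N by rewrite -mul2n -expnS prednK.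
  by rewrite -sumU -expnM leq_exp2l.
have [/existsP[i hi]|/existsPn h] :=
    boolP [exists i : 'I_n, 2 ^ n <= 2 * n ^ 2 * U i]%N.
  by exists i.
exfalso; have : (\sum_(i < n) (2 * n ^ 2 * U i).+1 <= \sum_(i < n) 2 ^ n)%N.
  by apply: leq_sum => i _; rewrite ltnNge h.
rewrite sum_nat_const card_ord; under eq_bigr do rewrite -addn1.
rewrite big_split /= sum_nat_const card_ord muln1 -big_distrr /=.
have -> : (2 ^ n = 2 * 2 ^ n.-1)%N by rewrite -expnS prednK.
by move: large; move: (2 ^ n.-1)%N (\sum_(i < n) U i)%N => x y; nia.
Qed.

(** * Dilates of separated centres *)

Lemma intr_Fp_inj (p : nat) (a b : int) : prime p -> (`|a - b|%N < p)%N ->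
  a%:~R = b%:~R :> 'F_p -> a = b.
Proof.
move=> pp hab /eqP; rewrite -subr_eq0 -rmorphB /= => h0.
apply/eqP; rewrite -subr_eq0 -absz_eq0; move: h0 hab; case: (a - b) => n /=.
  rewrite -(dvdn_pcharf (pchar_Fp pp)) => pn np.
  by case: n pn np => // n /dvdn_leq h np; move: (h isT); rewrite leqNgt np.
rewrite NegzE rmorphN oppr_eq0 /= -(dvdn_pcharf (pchar_Fp pp)).
by move=> /dvdn_leq h np; move: (h isT); rewrite leqNgt np.
Qed.

Lemma prod_primes_dvdn (s : seq nat) (n : nat) :
  uniq s -> {in s, forall u, prime u} -> {in s, forall u, u %| n}%N ->
  (\prod_(u <- s) u %| n)%N.
Proof.
elim: s => [|u s IH]; first by rewrite big_nil dvd1n.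
move=> /= /andP[us un] sp sd; rewrite big_cons Gauss_dvd.
  by rewrite sd ?mem_head //= IH // => v vs; [apply: sp|apply: sd]; rewrite in_cons vs orbT.
have up : prime u by apply: sp; rewrite mem_head.
rewrite prime_coprime // Euclid_dvd_prod // big_has; apply/hasPn => v vs.
rewrite dvdn_prime2 // ?sp ?in_cons ?vs ?orbT //.
by apply: contraNneq us => ->.
Qed.

(** The product of the distinct primes found divides [n], and each of them exceeds [D]. *)
Lemma card_prime_divisors_leq (D n c : nat) (s : seq nat) :
  uniq s -> {in s, forall u, prime u && (D < u)%N} -> (1 < D)%N ->
  (0 < n < D ^ c.+1)%N -> (size [seq u <- s | u %| n] <= c)%N.
Proof.
move=> us sp D1 /andP[n0 nD]; rewrite -ltnS -(ltn_exp2l _ _ D1).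
apply: leq_ltn_trans nD; set t := [seq _ <- _ | _].
have tp : {in t, forall u, prime u && (D < u)%N}.
  by move=> u; rewrite mem_filter => /andP[_ /sp].
apply: (@leq_trans (\prod_(u <- t) u)%N).
  elim: (t) tp => [|u r IH] h; first by rewrite big_nil.
  rewrite big_cons expnS leq_mul //.
    by have /andP[_ /ltnW] := h u (mem_head _ _).
  by apply: IH => v vr; apply: h; rewrite in_cons vr orbT.
apply: dvdn_leq n0 (prod_primes_dvdn _ _ _); first exact: filter_uniq.
  by move=> u /tp/andP[].
by move=> u; rewrite mem_filter => /andP[].
Qed.

(** Sets are added one at a time; each new one meets the union of the others in at most [b] points
    per earlier set. *)
Lemma bonferroni (I T : finType) (A : I -> {set T}) (a b : nat) (s : seq I) :
  uniq s -> {in s, forall i, a <= #|A i|}%N ->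
  {in s &, forall i j, i != j -> #|A i :&: A j| <= b}%N ->
  (size s * a <= #|\bigcup_(i <- s) A i| + size s ^ 2 * b)%N.
Proof.
elim: s => [|i s IH] //= /andP[ins us] ha hb.
have ha' : {in s, forall i, a <= #|A i|}%N by move=> j js; apply: ha; rewrite in_cons js orbT.
have hb' : {in s &, forall i j, i != j -> #|A i :&: A j| <= b}%N.
  by move=> j k js ks; apply: hb; rewrite in_cons ?js ?ks orbT.
have {IH} := IH us ha' hb'; rewrite big_cons cardsU.
have hI : (#|A i :&: \bigcup_(j <- s) A j| <= size s * b)%N.
  have {hb' ha' us}: {in s, forall j, #|A i :&: A j| <= b}%N.
    move=> j js; apply: hb; rewrite ?mem_head ?in_cons ?js ?orbT //.
    by apply: contraNneq ins => ->.
  elim: s {ins ha hb} => [|j s IHs] h; first by rewrite big_nil setI0 cards0.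
  rewrite big_cons setIUr /= mulSn; apply: leq_trans (leq_card_setU _ _) _.
  rewrite leq_add ?h ?mem_head // IHs // => k ks; apply: h; by rewrite in_cons ks orbT.
have := ha i (mem_head _ _).
have : (#|A i :&: \bigcup_(j <- s) A j| <= #|\bigcup_(j <- s) A j|)%N.
  by apply: subset_leq_card; apply: subsetIr.
move: hI; move: (size s) #|A i :&: _| #|A i| #|\bigcup_(j <- s) A j|; nia.
Qed.

Section Dilates.

Variables (p D : nat) (N : 'I_D -> 'F_p) (U : {set 'I_(D.*2.+1)}).
Hypotheses (pp : prime p) (pD : (20 * D ^ 4 < p)%N) (D5 : (5 < D)%N).
Hypothesis primeU : forall u : 'I_(D.*2.+1), u \in U -> prime u && (D < u)%N.
Hypothesis Nsep : forall (i j : 'I_D) (k l : 'I_D), i != j -> N i + k%:R != N j + l%:R.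
Hypothesis Nneq0 : forall (i k : 'I_D), N i + k%:R != 0.

Definition dilate (x : 'I_D * 'I_D * 'I_(D.*2.+1)) : 'F_p :=
  (N x.1.1 + x.1.2%:R) / x.2%:R.

(** The signed numerator [n], with [|n| <= 4 * D ^ 2], is stored as [t = n + 4 * D ^ 2], so that
    both quantifiers range over ordinals and the predicate is boolean. *)
Definition small_fraction (i : 'I_D) : bool :=
  [exists d : 'I_D.+1, [exists t : 'I_(8 * D ^ 2).+1,
     (0 < d)%N && (d%:R * N i == t%:R - (4 * D ^ 2)%:R)]].

Lemma small_fractionP (i : 'I_D) :
  reflect (exists dn : nat * int, [/\ (0 < dn.1 <= D)%N, (`|dn.2| <= 4 * D ^ 2)%N
             & dn.1%:R * N i = dn.2%:~R])
    (small_fraction i).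
Proof.
apply: (iffP existsP) => [[d /existsP[t /andP[d0 /eqP e]]]|[[d n] /= [/andP[d0 dD] nD e]]].
  exists (d : nat, (t : nat)%:Z - (4 * D ^ 2)%N%:Z) => /=; split.
  - by rewrite d0 -ltnS ltn_ord.
  - have := ltn_ord t; lia.
  - by rewrite e rmorphB.
have dD' : (d < D.+1)%N by [].
exists (Ordinal dD'); apply/existsP.
have tP : (`|(n + (4 * D ^ 2)%N%:Z)%R| < (8 * D ^ 2).+1)%N by lia.
exists (Ordinal tP) => /=; rewrite d0 e /=.
have -> : (`|(n + (4 * D ^ 2)%N%:Z)%R|%N)%:R = (n + (4 * D ^ 2)%N%:Z)%:~R :> 'F_p.
  by rewrite -[LHS]/((`|_|%N%:Z)%:~R) gez0_abs //; lia.
by rewrite rmorphD addrK.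
Qed.

Let D2D4 : (6 * D ^ 3 <= D ^ 4)%N.
Proof. by rewrite (expnS _ 3) leq_mul2r D5 orbT. Qed.

Let D2D3 : (6 * D ^ 2 <= D ^ 3)%N.
Proof. by rewrite (expnS _ 2) leq_mul2r D5 orbT. Qed.

Let Dp : (20 * D < p)%N.
Proof.
apply: leq_ltn_trans pD; rewrite leq_mul2l -[X in (X <= _)%N]expn1.
by rewrite leq_exp2l ?orbT // (ltn_trans _ D5).
Qed.

Let leU (u : 'I_(D.*2.+1)) : (u <= 2 * D)%N.
Proof. by rewrite mul2n -ltnS. Qed.

Lemma dilate_den_neq0 u : u \in U -> u%:R != 0 :> 'F_p.
Proof.
move=> /primeU/andP[up uD]; apply: natf_neq0_Fp => //.
by rewrite prime_gt0 //=; have := leU u; move: Dp; clear; lia.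
Qed.

Lemma dilate_eq i k u j l v : u \in U -> v \in U ->
  dilate (i, k, u) = dilate (j, l, v) ->
  (N i + k%:R) * v%:R = (N j + l%:R) * u%:R.
Proof.
move=> uU vU /eqP; rewrite /dilate /= eqr_div ?dilate_den_neq0 // => /eqP.
by [].
Qed.

Lemma shift_eq (i k j l : 'I_D) : N i + k%:R = N j + l%:R -> i = j /\ k = l.
Proof.
have [->|ij] := eqVneq i j; last by move/eqP; rewrite (negPf (Nsep k l ij)).
move=> /addrI e; split=> //; apply: val_inj => /=.
apply/eqP; rewrite -eqz_nat; apply/eqP; apply: (@intr_Fp_inj p) => //.
by have := ltn_ord k; have := ltn_ord l; lia.
Qed.

(* Dilates of small fractions are compared as rational numbers: a prime
   [u > D] that does not divide the numerator is visible in the denominator. *)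
Lemma card_dilates_small_fraction (L : {set 'F_p}) :
  (forall i k u, u \in U -> dilate (i, k, u) \in L) ->
  (#|[set i | small_fraction i]| * D * (#|U| - 2) <= #|L|)%N.
Proof.
move=> hL; set B := [set i | _].
have /fin_all_exists[dn hdn] : forall i, exists dn : nat * int, i \in B ->
    [/\ (0 < dn.1 <= D)%N, (`|dn.2| <= 4 * D ^ 2)%N & dn.1%:R * N i = dn.2%:~R].
  move=> i; case: (boolP (i \in B)) => iB; last by exists (0%N, 0).
  by move: (iB); rewrite inE => /small_fractionP[dn h]; exists dn.
pose num (i k : 'I_D) : int := (dn i).2 + ((dn i).1 * k)%N%:Z.
have numE i k : i \in B -> (num i k)%:~R = (dn i).1%:R * (N i + k%:R) :> 'F_p.
  by move=> /hdn[_ _ h]; rewrite mulrDr h rmorphD /= -[in RHS]natrM.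
have num_le i k : i \in B -> (`|num i k| <= 5 * D ^ 2)%N.
  move=> /hdn[/andP[_ dD] nD _]; rewrite /num.
  have : ((dn i).1 * k <= D * D)%N by rewrite leq_mul // ltnW.
  by rewrite mulnn; move: nD; move: ((dn i).1 * k)%N (D ^ 2)%N => a b; lia.
have dn_neq0 i : i \in B -> (dn i).1%:R != 0 :> 'F_p.
  move=> /hdn[/andP[d0 dD] _ _]; apply: natf_neq0_Fp => //; rewrite d0; lia.
have num_neq0 i k : i \in B -> (0 < `|num i k|)%N.
  move=> iB; rewrite absz_gt0; apply/negP => /eqP n0.
  have /eqP := numE i k iB; rewrite n0 eq_sym mulf_eq0.
  by rewrite (negPf (dn_neq0 _ iB)) (negPf (Nneq0 _ _)).
pose X := [set x : 'I_D * 'I_D * 'I_(D.*2.+1) |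
   [&& x.1.1 \in B, x.2 \in U & ~~ (x.2 %| `|num x.1.1 x.1.2|)%N]].
have injX : {in X &, injective dilate}.
  move=> [[i k] u] [[j l] v]; rewrite !inE /= => /and3P[iB0 uU und] /and3P[jB0 vU _].
  have iB : i \in B by rewrite inE. have jB : j \in B by rewrite inE.
  move=> /(dilate_eq uU vU) e.
  have /andP[up uD] := primeU uU; have /andP[vp vD] := primeU vU.
  have [[/andP[di0 diD] _ _] [/andP[dj0 djD] _ _]] := (hdn _ iB, hdn _ jB).
  have eF : (num i k * ((dn j).1 * v)%N%:Z)%:~R = (num j l * ((dn i).1 * u)%N%:Z)%:~R :> 'F_p.
    rewrite !intrM -!pmulrn !numE // !natrM.
    transitivity ((dn i).1%:R * (dn j).1%:R * ((N i + k%:R) * v%:R)); first by ring.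
    by rewrite e; ring.
  (* Both sides are at most [10 * D ^ 4] in absolute value, so [20 * D ^ 4 < p] lifts the congruence
     to the integers. *)
  have eZ : num i k * ((dn j).1 * v)%N%:Z = num j l * ((dn i).1 * u)%N%:Z.
    apply: intr_Fp_inj eF => //.
    have h (i0 k0 j0 : 'I_D) (w : 'I_(D.*2.+1)) : i0 \in B -> j0 \in B ->
        (`|(num i0 k0 * ((dn j0).1 * w)%N%:Z)%R| <= 10 * D ^ 4)%N.
      move=> i0B j0B; rewrite abszM.
      have [/andP[_ hd] _ _] := hdn _ j0B.
      apply: leq_trans (leq_mul (num_le _ _ i0B) (leq_mul hd (leU w))) _.
      by rewrite (_ : 5 * D ^ 2 * (D * (2 * D)) = 10 * D ^ 4)%N //; ring.
    have := h i k j v iB jB; have := h j l i u jB iB; move: pD.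
    by move: (num i k * _) (num j l * _) (D ^ 4)%N; clear; lia.
  (* [u] divides neither its own numerator nor a denominator at most [D], hence it divides the prime
     [v]. *)
  have uv : u = v.
    apply/eqP/negPn/negP => uv; case/negP: und.
    have : (u %| `|(num i k * ((dn j).1 * v)%N%:Z)%R|)%N.
      by rewrite eZ abszM /= mulnA dvdn_mull.
    rewrite abszM /= !Euclid_dvdM // (dvdn_prime2 up vp) => /or3P[//| |/eqP/val_inj/eqP].
      by move=> /(dvdn_leq dj0) /leq_trans/(_ djD); rewrite leqNgt uD.
    by rewrite (negPf uv).
  rewrite -{v vU vp vD eF eZ}uv in e *.
  by have [-> ->] := shift_eq (mulIf (dilate_den_neq0 uU) e).
(* Numerators are nonzero and at most [5 * D ^ 2 < D ^ 3], so each one excludes at most two primes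
   of [U]. *)
have lowX : (#|B| * D * (#|U| - 2) <= #|X|)%N.
  have -> : #|X| = (\sum_(x in setX B [set: 'I_D])
      \sum_(u in U | ~~ (u %| `|num x.1 x.2|)) 1)%N.
    rewrite pair_big_dep -sum1_card /=; apply: eq_bigl => -[[i k] u].
    by rewrite !inE /= andbT.
  have <- : #|setX B [set: 'I_D]| = (#|B| * D)%N by rewrite cardsX cardsT card_ord.
  rewrite -sum_nat_const; apply: leq_sum => -[i k] /=; rewrite inE => /andP[/= iB _].
  rewrite sum1_card leq_subLR.
  rewrite -(cardID [pred u : 'I_(D.*2.+1) | u %| `|num i k|]%N U) leq_add //; last first.
    by apply: subset_leq_card; apply/subsetP => u; rewrite !inE andbC.
  rewrite cardE -(size_map val); set s := map _ _.
  have ds : {in s, forall u, u \in map val (enum U) /\ (u %| `|num i k|)%N}.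
    move=> u /mapP[u']; rewrite mem_enum => /andP[/= h1 h2] ->.
    by rewrite map_f ?mem_enum.
  have -> : s = [seq u <- s | u %| `|num i k|]%N.
    by apply/esym/all_filterP/allP => u /ds[].
  apply: (@card_prime_divisors_leq D) => //.
  - by rewrite map_inj_uniq ?enum_uniq //; apply: val_inj.
  - by move=> u /ds[/mapP[u' + ->] _]; rewrite mem_enum => /primeU.
  - by lia.
  - rewrite num_neq0 //=; apply: leq_ltn_trans (num_le _ _ iB) _.
    apply: leq_trans D2D3; lia.
apply: leq_trans lowX _; have <- : #|dilate @: X| = #|X| by apply: card_in_imset.
apply: subset_leq_card; apply/subsetP => y /imsetP[[[i k] u]].
by rewrite inE => /and3P[_ uU _] ->; apply: hL.
Qed.

(* For other centres, two dilates of [N j] by the same [u] cannot both be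
   dilates of [N i], so each intersection has at most [#|U|] points. *)
Lemma card_dilates_large_fraction (L : {set 'F_p}) (c : nat) :
  (forall i k u, u \in U -> dilate (i, k, u) \in L) ->
  (c <= #|[set i | ~~ small_fraction i]|)%N ->
  (c * (D * #|U|) <= #|L| + c ^ 2 * #|U|)%N.
Proof.
move=> hL hc; set G := [set i | _] in hc.
(* Negating [n] if necessary allows multipliers [d] of either sign. *)
have largeG i d (n : int) : i \in G -> (`|d|%N <= D)%N -> (`|n| <= 4 * D ^ 2)%N ->
    d%:~R * N i = n%:~R -> d = 0.
  rewrite inE => /small_fractionP h dD nD e; apply/eqP/negPn/negP => d0; apply: h.
  have d0' : (0 < `|d|)%N by rewrite absz_gt0.
  have [dpos|dneg] := lerP 0 d.
    exists (`|d|%N, n); split => //=; first by rewrite d0' dD.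
    by rewrite -e -[in RHS](gez0_abs dpos) -pmulrn.
  exists (`|d|%N, - n); split => //=; first by rewrite d0' dD.
    by rewrite abszN.
  by rewrite rmorphN /= -e -mulNr -rmorphN /= -[in RHS](ltz0_abs dneg) -pmulrn.
pose A i : {set 'F_p} := [set dilate (i, x.1, x.2) | x in setX [set: 'I_D] U].
have cardA i : i \in G -> #|A i| = (D * #|U|)%N.
  move=> iG; rewrite card_in_imset ?cardsX ?cardsT ?card_ord //.
  move=> [k u] [l v]; rewrite !inE /= => uU vU /(dilate_eq uU vU) e.
  (* The equality reads [(v - u) * N i = l * u - k * v], a relation too small for this centre unless
     [u = v]. *)
  have uv : u = v.
    have : (v : nat)%:Z - (u : nat)%:Z = 0.
      apply: (largeG i _ ((l * u)%N%:Z - (k * v)%N%:Z) iG).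
      - have /andP[_] := primeU uU; have /andP[_] := primeU vU.
        by have := leU u; have := leU v; clear; lia.
      - have : (l * u <= D * (2 * D))%N by rewrite leq_mul // ltnW.
        have : (k * v <= D * (2 * D))%N by rewrite leq_mul // ltnW.
        by rewrite mulnCA mulnn; move: (k * v)%N (l * u)%N (D ^ 2)%N; clear; lia.
      rewrite !rmorphB /= -!pmulrn !natrM mulrBl.
      apply/eqP; rewrite -subr_eq0; apply/eqP.
      transitivity ((N i + k%:R) * v%:R - (N i + l%:R) * u%:R); first by ring.
      by rewrite e subrr.
    by move=> h; apply: val_inj => /=; move: h; clear; lia.
  rewrite -{v vU}uv in e *.
  by have [_ ->] := shift_eq (mulIf (dilate_den_neq0 uU) e).
have cardAI i j : i \in G -> j \in G -> i != j -> (#|A i :&: A j| <= #|U|)%N.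
  move=> iG jG ij.
  (* [w] chooses for each common point its two representations. The prime [v] of the representation
     at [j] will turn out to determine the point. *)
  have /fin_all_exists[w hw] : forall x : 'F_p,
    exists kulv : 'I_D * 'I_(D.*2.+1) * 'I_D * 'I_(D.*2.+1),
     x \in A i :&: A j -> [/\ kulv.1.1.2 \in U, kulv.2 \in U,
        x = dilate (i, kulv.1.1.1, kulv.1.1.2) & x = dilate (j, kulv.1.2, kulv.2)].
    move=> x; case: (boolP (x \in _)) => [|_]; last first.
      by exists (i, ord0, i, ord0).
    rewrite inE => /andP[/imsetP[[k u] + e1] /imsetP[[l v] + e2]].
    by rewrite !inE /= => uU vU; exists (k, u, l, v).
  have injw : {in A i :&: A j &, injective (fun x => (w x).2)}.
    move=> x y /hw; case: (w x) => -[[k1 u1] l1] v1 /= [u1U v1U ex1 ex2].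
    move=> /hw; case: (w y) => -[[k2 u2] l2] v2 /= [u2U v2U ey1 ey2] ev.
    rewrite -{v2 v2U}ev in ey2.
    have e1 := dilate_eq u1U v1U (etrans (esym ex1) ex2).
    have e2 := dilate_eq u2U v1U (etrans (esym ey1) ey2).
    (* Eliminating [N i] between [e1] and [e2] leaves [(u1 - u2) * N j] equal to an integer made of
       two positive and two negative terms, each at most [2 * D ^ 2] in size. *)
    have uu : u1 = u2.
      have : (u1 : nat)%:Z - (u2 : nat)%:Z = 0.
        apply: (largeG j _ ((k1 * v1)%N%:Z - (k2 * v1)%N%:Z - (l1 * u1)%N%:Z + (l2 * u2)%N%:Z) jG).
        - have /andP[_] := primeU u1U; have /andP[_] := primeU u2U.
          by have := leU u1; have := leU u2; clear; lia.
        - have hm (a : 'I_D) (b : 'I_(D.*2.+1)) : (a * b <= 2 * D ^ 2)%N.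
            by rewrite -mulnn mulnCA leq_mul // ltnW.
          have := hm k1 v1; have := hm k2 v1; have := hm l1 u1; have := hm l2 u2.
          move: (k1 * v1)%N (k2 * v1)%N (l1 * u1)%N (l2 * u2)%N.
          by move: (D ^ 2)%N (D ^ 3)%N (D ^ 4)%N D2D3 D2D4 pD; clear; lia.
        rewrite !(rmorphB, rmorphD) /= -!pmulrn !natrM.
        apply/eqP; rewrite -subr_eq0; apply/eqP.
        transitivity (((N j + l1%:R) * u1%:R - (N i + k1%:R) * v1%:R)
           - ((N j + l2%:R) * u2%:R - (N i + k2%:R) * v1%:R)); first by ring.
        by rewrite e1 e2 !subrr.
      by move=> h; apply: val_inj => /=; move: h; clear; lia.
    rewrite -{u2 u2U}uu in e2 ey1.
    have u1v1 : u1 != v1.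
      apply: contraTneq ij => uv; rewrite uv in e1.
      by have [-> _] := shift_eq (mulIf (dilate_den_neq0 v1U) e1); rewrite eqxx.
    have eZ : (k1 * v1 + l2 * u1)%N%:Z = (k2 * v1 + l1 * u1)%N%:Z.
      apply: (@intr_Fp_inj p) => //.
        have hm (a : 'I_D) (b : 'I_(D.*2.+1)) : (a * b <= 2 * D ^ 2)%N.
          by rewrite -mulnn mulnCA leq_mul // ltnW.
        have := hm k1 v1; have := hm k2 v1; have := hm l1 u1; have := hm l2 u1.
        move: (k1 * v1)%N (k2 * v1)%N (l1 * u1)%N (l2 * u1)%N.
        by move: (D ^ 2)%N (D ^ 3)%N (D ^ 4)%N D2D3 D2D4 pD; clear; lia.
      rewrite -!pmulrn !natrD !natrM.
      apply/eqP; rewrite -subr_eq0; apply/eqP.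
      transitivity (((N i + k1%:R) * v1%:R - (N j + l1%:R) * u1%:R)
         - ((N i + k2%:R) * v1%:R - (N j + l2%:R) * u1%:R)); first by ring.
      by rewrite e1 e2 !subrr.
    have /andP[u1p u1D] := primeU u1U; have /andP[v1p v1D] := primeU v1U.
    (* Over the integers [(k1 - k2) * v1 = (l1 - l2) * u1], so [u1] divides [k1 - k2], which is
       smaller than [D < u1]. *)
    have ekk : k1 = k2.
      have : (u1 %| `|((k1 : nat)%:Z - (k2 : nat)%:Z)%R|)%N.
        have : (u1 %| `|(((k1 : nat)%:Z - (k2 : nat)%:Z) * (v1 : nat)%:Z)%R|)%N.
          rewrite (_ : _ * _ = ((l1 : nat)%:Z - (l2 : nat)%:Z) * (u1 : nat)%:Z).
            by rewrite abszM dvdn_mull.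
          move: eZ; rewrite !PoszD !PoszM => eZ.
          apply/eqP; rewrite -subr_eq0; apply/eqP.
          rewrite -[RHS](subrr ((k1 : nat)%:Z * (v1 : nat)%:Z + (l2 : nat)%:Z * (u1 : nat)%:Z)).
          by rewrite [in X in _ = _ - X]eZ; ring.
        rewrite abszM Euclid_dvdM // => /orP[//|].
        by rewrite (dvdn_prime2 u1p v1p) => /eqP/val_inj/eqP; rewrite (negPf u1v1).
      move=> d; apply: val_inj => /=; apply/eqP; rewrite -eqz_nat -subr_eq0 -absz_eq0.
      apply: contraTT d; rewrite -lt0n => h; apply/negP => /(dvdn_leq h).
      by have := ltn_ord k1; have := ltn_ord k2; move: u1D; clear; lia.
    by rewrite ex1 ey1 ekk.
  rewrite -(card_in_imset injw); apply: subset_leq_card.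
  by apply/subsetP => z /imsetP[x /hw[]] ? ? ? ? ->.
have := @bonferroni _ _ A (D * #|U|) #|U| (take c (enum G)).
have sG : {subset take c (enum G) <= G} by move=> x /mem_take; rewrite mem_enum.
rewrite size_takel -?cardE // => /(_ _ _ _)/leq_trans; apply.
- by rewrite take_uniq ?enum_uniq.
- by move=> i /sG iG; rewrite cardA.
- by move=> i j /sG iG /sG jG; apply: cardAI.
rewrite leq_add2r; apply: subset_leq_card.
apply/subsetP => x; rewrite bigcup_seq => /bigcupP[i _ /imsetP[[k u]]].
by rewrite !inE /= => uU ->; apply: hL.
Qed.

(** At least half of the centres are of one kind. With [c = D / 2] large ones the loss
    [c ^ 2 * #|U|] is half of the main term; with small ones [#|U| - 2] is at least [#|U| / 2]. *)
Lemma card_dilates (L : {set 'F_p}) : ~~ odd D -> (5 < #|U|)%N ->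
  (forall i k u, u \in U -> dilate (i, k, u) \in L) ->
  (D ^ 2 * #|U| <= 4 * #|L|)%N.
Proof.
move=> evD U5 hL; have h1 := card_dilates_small_fraction hL.
have h2 := @card_dilates_large_fraction L D./2 hL.
have De : D = (2 * D./2)%N by rewrite mul2n -[LHS]odd_double_half (negPf evD).
have cs : (#|[set i | small_fraction i]| + #|[set i | ~~ small_fraction i]| = D)%N.
  have -> : [set i | ~~ small_fraction i] = ~: [set i | small_fraction i].
    by apply/setP => i; rewrite !inE.
  by rewrite cardsC card_ord.
case: (leqP D./2 #|[set i | ~~ small_fraction i]|) => hc.
  have {h2} := h2 hc; move: De; move: (D./2) #|U| #|L| => n u l ->.
  nia.
have hB : (D./2 <= #|[set i | small_fraction i]|)%N by lia.
have h3 : (D./2 * D * (#|U| - 2) <= #|L|)%N.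
  by apply: leq_trans h1; rewrite leq_mul2r leq_mul2r hB !orbT.
have h4 : (D * D * (#|U| - 2) <= 2 * #|L|)%N by nia.
have h5 : (D * D * #|U| <= D * D * (2 * (#|U| - 2)))%N by rewrite leq_mul2l; lia.
by rewrite -mulnn; nia.
Qed.

End Dilates.

(** * The cubic curve *)

(** The squares of [1, ..., e] are [e] distinct roots of [X^e - 1], so they are all of its roots. *)
Lemma qchar_eq1_square (p : nat) (y : 'F_p) : prime p -> (2 < p)%N ->
  y ^+ p./2 = 1 -> exists z, y = z ^+ 2.
Proof.
move=> pp p2 ye; set e := p./2 in ye.
have pe : p = (e * 2).+1 by apply: odd_half_prime.
have e0 : (0 < e)%N by rewrite half_gt0 ltnW.
pose R := [set x : 'F_p | x ^+ e == 1].
pose S := [set ((i : nat).+1%:R : 'F_p) ^+ 2 | i : 'I_e].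
have SR : S \subset R.
  apply/subsetP => x /imsetP[i _ ->]; rewrite inE -exprM mulnC.
  have i0 : (i.+1%:R : 'F_p) != 0.
    by apply: natf_neq0_Fp => //=; have := ltn_ord i; lia.
  by apply/eqP/(mulfI i0); rewrite -exprS mulr1 -pe expFp.
have cS : #|S| = e.
  rewrite card_imset ?card_ord // => i j /eqP; rewrite eqf_sqr => /orP[] /eqP.
    move=> h; have := @intr_Fp_inj p i.+1 j.+1 pp; rewrite -!pmulrn => /(_ _ h) h'.
    apply: val_inj => /=; have := ltn_ord i; have := ltn_ord j; move: h'; lia.
  have nz : (i.+1 + j.+1)%:R != 0 :> 'F_p.
    by apply: natf_neq0_Fp => //; have := ltn_ord i; have := ltn_ord j; lia.
  by move=> /eqP; rewrite -subr_eq0 opprK -natrD (negPf nz).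
have cR : (#|R| <= e)%N.
  have P0 : ('X^e - 1 : {poly 'F_p}) != 0 by rewrite -size_poly_gt0 size_XnsubC.
  have := max_poly_roots P0 (_ : all (root _) (enum R)) (enum_uniq _).
  rewrite size_XnsubC // ltnS -cardE; apply; apply/allP => x.
  by rewrite mem_enum inE rootE !hornerE subr_eq0.
have /eqP SR' : S == R by rewrite eqEcard SR cS cR.
have : y \in S by rewrite SR' inE ye.
by move=> /imsetP[i _ ->]; exists i.+1%:R.
Qed.

Lemma qchar_neqN1_square (p : nat) (y : 'F_p) : prime p -> (2 < p)%N ->
  qchar y != -1 -> exists z, y = z ^+ 2.
Proof.
move=> pp p2; have [->|y0] := eqVneq y 0; first by exists 0; rewrite expr0n.
by rewrite /qchar (negPf y0); case: (_ =P 1) => // /(qchar_eq1_square pp p2).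
Qed.

Lemma zresE (p : nat) (z : int) : prime p -> zres p z = (z%:~R : 'F_p).
Proof.
move=> pp; have pz : (p%:Z)%:~R = 0 :> 'F_p by rewrite -pmulrn pchar_Fp_0.
rewrite /zres {2}(divz_eq z p) intrD intrM pz mulr0 add0r.
have p0 : (p : int) != 0 by rewrite eqz_nat -lt0n prime_gt0.
have h0 := modz_ge0 z p0; have h1 := ltz_mod z p0.
rewrite -[in RHS](gez0_abs h0) -pmulrn (val_Fp_nat pp) modn_small //.
by have := prime_gt0 pp; lia.
Qed.

Section CubicCurve.

Variables (p : nat) (a c : int) (H : nat).
Hypotheses (pp : prime p) (p3 : (3 < p)%N) (ap : coprime `|a| p).

Definition cubic (x : 'F_p) : 'F_p := a%:~R * x ^+ 3 + c%:~R * x.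

Lemma ltn_Fp (x : 'F_p) : (x < p)%N.
Proof. by have := ltn_ord x; rewrite [X in (_ < X)%N](Fp_cast pp). Qed.

Definition curve_point (x : 'F_p) : 'I_p * 'I_p :=
  (Ordinal (ltn_Fp x), Ordinal (ltn_Fp (cubic x))).

Lemma curve_point_in (x : 'F_p) : curve_point x \in curveC p a c.
Proof.
have xE : ((x : nat)%:Z)%:~R = x by rewrite -pmulrn natr_Zp.
have e : cubic x = (a * (x : nat)%:Z ^+ 3 + c * (x : nat)%:Z)%:~R.
  by rewrite intrD !intrM xE /cubic !exprS expr0 mulr1.
rewrite inE; apply/eqP; rewrite zresE //.
exact: (congr1 (fun y : 'F_p => y : nat) e).
Qed.

Lemma curve_point_box (x : 'F_p) (X Y i j : nat) :
  (0 < i <= H)%N -> (0 < j <= H)%N ->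
  x = X%:R + i%:R -> cubic x = Y%:R + j%:R ->
  curve_point x \in boxB p X Y H.
Proof.
move=> /andP[i0 iH] /andP[j0 jH] ex ey; rewrite inE.
apply/existsP; exists (Ordinal (iH : (i < H.+1)%N)).
apply/existsP; exists (Ordinal (jH : (j < H.+1)%N)).
have e1 : x = (X%:Z + i%:Z)%:~R by rewrite intrD -!pmulrn.
have e2 : cubic x = (Y%:Z + j%:Z)%:~R by rewrite intrD -!pmulrn.
apply/and4P; split=> //; apply/eqP; rewrite zresE //.
  exact: (congr1 (fun y : 'F_p => y : nat) e1).
exact: (congr1 (fun y : 'F_p => y : nat) e2).
Qed.

Hypothesis noX : forall X Y : nat, (X <= p - 1)%N -> (Y <= p - 1)%N ->
  (#|curveC p a c :&: boxB p X%:Z Y%:Z H| <= 1)%N.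

(** Two such points would share a box. Offsets in a box start at [1], so its corner lies one step
    before the first abscissa and before the lower ordinate. *)
Lemma no_close_points (x : 'F_p) (h : nat) (k : int) :
  (h < H)%N -> (`|k| < H)%N -> h%:R != 0 :> 'F_p ->
  cubic (x + h%:R) - cubic x != k%:~R.
Proof.
move=> hH kH h0; apply/eqP => e.
have le_p1 (y : 'F_p) : (y <= p - 1)%N by have := ltn_Fp y; lia.
have H0 : (0 < H)%N by apply: leq_ltn_trans kH.
(* The sign of [k] tells which of the two ordinates is the lower one. *)
have [Y [j [j' [hj hj' e1 e2]]]] : exists (Y : 'F_p) (j j' : nat),
    [/\ (0 < j <= H)%N, (0 < j' <= H)%N, cubic x = (Y : nat)%:R + j%:R
      & cubic (x + h%:R) = (Y : nat)%:R + j'%:R].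
  case: k kH e => k /= kH e.
    exists (cubic x - 1), 1%N, k.+1; split => //; rewrite natr_Zp ?subrK //.
    by move: e; rewrite -pmulrn => /eqP; rewrite subr_eq => /eqP ->; rewrite -(@natr1 _ k); ring.
  exists (cubic (x + h%:R) - 1), k.+2, 1%N; split => //; rewrite natr_Zp ?subrK //.
  move: e; rewrite NegzE mulrNz -pmulrn => /eqP; rewrite subr_eq => /eqP ->.
  by rewrite -(@natr1 _ k.+1); ring.
have := noX (le_p1 (x - 1)) (le_p1 Y); apply/negP; rewrite -ltnNge.
have neq : curve_point x != curve_point (x + h%:R).
  apply: contra h0 => /eqP[e0 _]; have /eqP := ord_inj (e0 : x = x + h%:R :> nat).
  rewrite -subr_eq0 opprD addrA subrr.
  by rewrite add0r oppr_eq0.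
have <- : #|[set curve_point x; curve_point (x + h%:R)]| = 2%N by rewrite cards2 neq.
apply: subset_leq_card; apply/subsetP => P; rewrite in_set2 => /orP[] /eqP ->;
  rewrite in_setI curve_point_in andTb.
  by apply: (@curve_point_box _ _ _ 1 j) => //; rewrite ?natr_Zp ?subrK.
apply: (@curve_point_box _ _ _ h.+1 j') => //.
by rewrite natr_Zp -(@natr1 _ h); ring.
Qed.

(** If the argument were a square [z ^+ 2], zero included, then [x = z / (3 a g)] would make the
    ordinates at [x - g] and [x + g] differ by [6 a g x^2 + 2 f g = - 2 k]. *)
Lemma qchar_cubic (g k : nat) : (0 < g)%N -> (g.*2 < H)%N -> (g.*2 < p)%N ->
  (k.*2 < H)%N -> qchar ((- 3%:R * a%:~R * g%:R) * (cubic g%:R + k%:R)) = -1.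
Proof.
move=> g0 gH gp kH; apply/eqP/negPn/negP => /(qchar_neqN1_square pp (ltnW p3))[z ez].
have a0 : (a%:~R : 'F_p) != 0.
  apply/eqP => az; have /eqP : zres p a = 0%N by rewrite zresE // az.
  rewrite absz_eq0 => /eqP/dvdz_mod0P; rewrite dvdzE /= => pa.
  by move: ap; rewrite coprime_sym prime_coprime // pa.
have g0' : (g%:R : 'F_p) != 0 by apply: natf_neq0_Fp => //; lia.
have q0 : (3%:R * a%:~R * g%:R : 'F_p) != 0.
  by rewrite !mulf_neq0 // natf_neq0_Fp.
pose x := z / (3%:R * a%:~R * g%:R).
have zE : z = x * (3%:R * a%:~R * g%:R) by rewrite /x divfK.
have xE : 3%:R * a%:~R * g%:R * x ^+ 2 = - (cubic g%:R + k%:R).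
  apply: (mulfI q0); transitivity (z ^+ 2); first by rewrite zE; ring.
  by rewrite -ez; ring.
have := @no_close_points (x - g%:R) g.*2 (- (k.*2)%:Z) gH.
rewrite abszN => /(_ kH) /(_ _)/negP; apply.
  by apply: natf_neq0_Fp => //; lia.
rewrite rmorphN /= -pmulrn -!mul2n !natrM /cubic.
apply/eqP; move: xE; rewrite /cubic => xE.
transitivity (2%:R * (3%:R * a%:~R * g%:R * x ^+ 2)
   + 2%:R * (a%:~R * g%:R ^+ 3 + c%:~R * g%:R)); first by ring.
by rewrite xE; ring.
Qed.

End CubicCurve.

(** Adding [v] to the dilate [(N g + k) / u] replaces [k] by [k + u * v], which is at most
    [D + 2 * D * V] and stays in the range of [qchar_cubic]. Hence all dilates start long runs, and
    the lower and upper bounds for their number are compared. *)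
Lemma prime_dilates_bound (p : nat) (a c : int) (H m V r D : nat) (U : {set 'I_(D.*2.+1)}) :
  prime p -> (3 < p)%N -> coprime `|a| p ->
  (forall X Y : nat, (X <= p - 1)%N -> (Y <= p - 1)%N ->
     (#|curveC p a c :&: boxB p X%:Z Y%:Z H| <= 1)%N) ->
  (1 < m)%N -> (4 * m ^ 2 <= p)%N -> (p <= 16 * m ^ 2)%N -> (V < p)%N ->
  ~~ odd r -> (m <= 'C(V, r))%N -> (4 * (2 * r).+1 <= p)%N ->
  ~~ odd D -> (5 < D)%N -> (20 * D ^ 4 < p)%N -> (2 * D * (4 * V + 2) < H)%N ->
  (forall u : 'I_(D.*2.+1), u \in U -> prime u && (D < u)%N) -> (5 < #|U|)%N ->
  (D ^ 2 * #|U| <= 4 * (m * (87 * r + 40)))%N.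
Proof.
move=> pp p3 ap noX m1 mp pm Vp evr mC rp evD D5 pD hHD primeU U5.
have D4 : (D <= D ^ 4)%N by rewrite -[X in (X <= _)%N]expn1 leq_exp2l // (ltn_trans _ D5).
have Dp : (20 * D < p)%N by apply: leq_ltn_trans pD; rewrite leq_mul2l D4 orbT.
have DH : (4 * D < H)%N by apply: leq_ltn_trans hHD; nia.
have DVH : (2 * (D + 2 * D * V) < H)%N by apply: leq_ltn_trans hHD; nia.
(* The index is shifted since [qchar_cubic] needs a positive [g]. *)
pose N (g : 'I_D) : 'F_p := cubic a c (g.+1%:R).
have Nsep (g h k l : 'I_D) : g != h -> N g + k%:R != N h + l%:R.
  wlog gh : g h k l / (g < h)%N.
    move=> W gh; case: (ltngtP g h) => [hlt|hlt|/ord_inj e]; first exact: W.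
      by rewrite eq_sym; apply: W => //; rewrite eq_sym.
    by rewrite e eqxx in gh.
  move=> _; apply/eqP => e.
  have := @no_close_points p a c H pp p3 ap noX g.+1%:R (h - g)%N ((k : nat)%:Z - (l : nat)%:Z).
  have := ltn_ord g; have := ltn_ord h; have := ltn_ord k; have := ltn_ord l => lD kD hD gD.
  move=> /(_ _ _ _)/negP; apply.
  - by move: hD DH; clear; lia.
  - by move: lD kD DH; clear; lia.
  - by apply: natf_neq0_Fp => //; move: gh hD Dp; clear; lia.
  rewrite -natrD (_ : g.+1 + (h - g) = h.+1)%N; last by move: gh; clear; lia.
  rewrite intrB -!pmulrn -/(N h) -/(N g) -subr_eq0.
  rewrite (_ : _ - _ = (N h + l%:R) - (N g + k%:R)); last by ring.
  by rewrite e subrr.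
have qN (g : 'I_D) (k : nat) : (k <= D + 2 * D * V)%N ->
    qchar (- 3%:R * a%:~R * g.+1%:R : 'F_p) * qchar (N g + k%:R) = -1.
  move=> kD; have gD := ltn_ord g; rewrite -qcharM ?(ltnW p3) //.
  apply: (qchar_cubic pp p3 ap noX) => //.
  - by move: gD DH; clear; lia.
  - by move: gD Dp; clear; lia.
  - by move: kD DVH; move: (2 * D * V)%N; clear; lia.
have Nneq0 (g k : 'I_D) : N g + k%:R != 0.
  have kD : (k <= D + 2 * D * V)%N by apply: leq_trans (leq_addr _ _); apply: ltnW.
  apply/eqP => e; have /eqP := qN g k kD.
  by rewrite e qchar0 mulr0 eq_sym oppr_eq0 oner_eq0.
pose L := [set dilate N (x.1, x.2) | x in setX [set: 'I_D * 'I_D] U].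
have hL g k u : u \in U -> dilate N (g, k, u) \in L.
  by move=> uU; apply/imsetP; exists ((g, k), u) => //; rewrite in_setX in_setT.
apply: leq_trans (card_dilates pp pD D5 primeU Nsep Nneq0 evD U5 hL) _.
rewrite leq_mul2l /=.
apply: (constant_qchar_runs pp (ltnW p3) m1 mp pm Vp evr mC rp).
move=> x /imsetP[[[g k] u]]; rewrite in_setX /= => /andP[_ uU] ->.
have u0 : (u%:R : 'F_p) != 0 by apply: dilate_den_neq0 uU.
(* On the run, [N g + k + u * v] has the character opposite to that of [- 3 a g]; dividing by [u]
   contributes the other factor. *)
exists (qchar (u%:R^-1 : 'F_p) * - qchar (- 3%:R * a%:~R * g.+1%:R : 'F_p)).
  rewrite exprMn sqrrN !qchar_sqr invr_eq0 u0 /=.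
  case: eqP => // e0; have /eqP := qN g 0%N (leq0n _).
  by rewrite e0 qchar0 mul0r eq_sym oppr_eq0 oner_eq0.
move=> v; rewrite /dilate /=.
have -> : (N g + k%:R) / u%:R + v.+1%:R = u%:R^-1 * (N g + (k + u * v.+1)%N%:R).
  by rewrite natrD natrM; field.
rewrite qcharM ?(ltnW p3) //; congr (_ * _).
have kD : (k + u * v.+1 <= D + 2 * D * V)%N.
  by rewrite leq_add ?leq_mul // ?(ltnW (ltn_ord k)) // mul2n -ltnS.
have := qN g _ kD; have := qchar_sqr (- 3%:R * a%:~R * g.+1%:R : 'F_p).
set q := @qchar p _; set q' := @qchar p _.
case: eqP => [z|_]; last by rewrite expr2 => q1 q2; rewrite -[q']mul1r -[1]q1 -mulrA q2 mulrN1.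
by rewrite /q z qchar0 mul0r => _ /eqP; rewrite eq_sym oppr_eq0 oner_eq0.
Qed.

(** The dyadic scale [D] rich in primes may be well below [2 ^ n], but [D >= #|U|] because [U] lies
    in [(D, 2 D]]. So [D ^ 2 * #|U|] is at least [#|U| ^ 3], itself at least
    [2 ^ (3 n) / (8 n ^ 6)]. *)
Lemma two_points_in_box (p : nat) (a c : int) (H n m V r : nat) :
  prime p -> (3 < p)%N -> coprime `|a| p ->
  (1 < m)%N -> (4 * m ^ 2 <= p)%N -> (p <= 16 * m ^ 2)%N -> (V < p)%N ->
  ~~ odd r -> (m <= 'C(V, r))%N -> (4 * (2 * r).+1 <= p)%N ->
  (0 < n)%N -> (12 * n ^ 2 <= 2 ^ n)%N -> (20 * (2 ^ n) ^ 4 < p)%N ->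
  (32 * n ^ 6 * (m * (87 * r + 40)) < 2 ^ (3 * n))%N ->
  ((2 ^ n * (4 * V + 2)) < H)%N ->
  exists X Y : nat, (X <= p - 1)%N /\ (Y <= p - 1)%N /\
    (2 <= #|curveC p a c :&: boxB p X%:Z Y%:Z H|)%N.
Proof.
move=> pp p3 ap m1 mp pm Vp evr mC rp n0 n2 np big hH.
case: (boolP [exists X : 'I_p, exists Y : 'I_p,
    2 <= #|curveC p a c :&: boxB p (X : nat)%:Z (Y : nat)%:Z H|]%N).
  move=> /existsP[X /existsP[Y hXY]]; exists X, Y.
  by have := ltn_ord X; have := ltn_ord Y; split; [lia|split=> //; lia].
move=> /existsPn hno; exfalso.
have noX X Y : (X <= p - 1)%N -> (Y <= p - 1)%N ->
    (#|curveC p a c :&: boxB p X%:Z Y%:Z H| <= 1)%N.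
  move=> hX hY; have Xp : (X < p)%N by lia.
  have Yp : (Y < p)%N by lia.
  by have /existsPn/(_ (Ordinal Yp)) := hno (Ordinal Xp); rewrite -ltnNge ltnS.
have [i ilt hi] := dyadic_primes n0; set s := [seq _ <- _ | _] in hi.
pose D := (2 ^ i)%N.
have D2 : (2 ^ i.+1 = D.*2)%N by rewrite expnS mul2n.
have Dn : (2 * D <= 2 ^ n)%N by rewrite mul2n -D2 leq_exp2l.
pose U := [set u : 'I_(D.*2.+1) | prime u && (D < u)%N].
have primeU (u : 'I_(D.*2.+1)) : u \in U -> prime u && (D < u)%N by rewrite inE.
have us : uniq s by rewrite filter_uniq ?iota_uniq.
have sU : (size s <= #|U|)%N.
  rewrite cardE -(size_map val); apply: uniq_leq_size => // q.
  rewrite mem_filter mem_index_iota D2 => /andP[qp /andP[Dq qD]].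
  by apply/mapP; exists (Ordinal qD) => //; rewrite mem_enum inE /= qp.
have UD : (#|U| <= D)%N.
  rewrite cardE -(size_map val) -[X in (_ <= X)%N](size_iota D.+1 D).
  apply: uniq_leq_size; first by rewrite map_inj_uniq ?enum_uniq //; apply: val_inj.
  move=> q /mapP[u]; rewrite mem_enum => /primeU/andP[_ Du] ->.
  by rewrite mem_iota Du /= addSn addnn ltn_ord.
have n2U : (2 ^ n <= 2 * n ^ 2 * #|U|)%N by apply: leq_trans hi _; rewrite leq_mul2l sU orbT.
have U5 : (5 < #|U|)%N.
  have n1 : (0 < n ^ 2)%N by rewrite expn_gt0 n0.
  rewrite ltnNge; apply/negP => hU; have := leq_trans n2 n2U.
  by move: n1 hU; move: (n ^ 2)%N #|U|; clear; nia.
have D5 : (5 < D)%N by apply: leq_trans UD.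
have evD : ~~ odd D.
  by move: D5; rewrite /D; case: (i) => // k _; rewrite expnS oddM.
have pD : (20 * D ^ 4 < p)%N.
  apply: leq_ltn_trans np; rewrite leq_mul2l leq_exp2r //.
  by apply: leq_trans Dn; rewrite leq_pmull.
have hHD : (2 * D * (4 * V + 2) < H)%N by apply: leq_ltn_trans hH; rewrite leq_mul2r Dn orbT.
have h := prime_dilates_bound pp p3 ap noX m1 mp pm Vp evr mC rp evD D5 pD hHD primeU U5.
have h3 : (#|U| ^ 3 <= 4 * (m * (87 * r + 40)))%N.
  by apply: leq_trans h; rewrite expnSr leq_mul2r leq_exp2r ?UD ?orbT.
have : ((2 ^ n) ^ 3 <= (2 * n ^ 2 * #|U|) ^ 3)%N by rewrite leq_exp2r.
rewrite -expnM mulnC leqNgt => /negP; apply; apply: leq_ltn_trans big.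
rewrite !expnMn -expnD; move: (leq_mul (leqnn (n ^ 6)) h3).
by move: (n ^ 6)%N (#|U| ^ 3)%N (m * _)%N; clear; lia.
Qed.

(** * Choice of the parameters *)

(** After multiplication by [r!] the factors compare one by one: [w * (r - i) <= r * w - i]. *)
Lemma expn_leq_bin (r w : nat) : (w ^ r <= 'C(r * w, r))%N.
Proof.
case: w => [|w]; first by case: r => // r; rewrite exp0n.
rewrite -(leq_pmul2r (fact_gt0 r)) bin_ffact -ffactnn !ffact_prod.
rewrite -[X in (w.+1 ^ X)%N](card_ord r) -prod_nat_const -big_split /=.
apply: leq_prod => i _; rewrite mulnBr [(w.+1 * r)%N]mulnC leq_sub2l //.
by rewrite leq_pmull.
Qed.

Lemma poly_lt_exp (C : nat) : exists t0, forall t, (t0 <= t)%N -> (C * t.+1 ^ 6 < 8 ^ t)%N.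
Proof.
exists (C * 12 ^ 6)%N => t Ct; set q := (t %/ 12)%N.
have tq : (t.+1 <= 12 * 2 ^ q)%N.
  have := ltn_ceil t (isT : 0 < 12)%N; rewrite -/q mulnC => /leq_trans; apply.
  by rewrite leq_mul2l ltn_expl.
have h1 : (t.+1 ^ 6 <= 12 ^ 6 * 2 ^ t)%N.
  apply: leq_trans (_ : (12 * 2 ^ q) ^ 6 <= _)%N; first by rewrite leq_exp2r.
  rewrite expnMn -expnM leq_mul2l leq_exp2l //=.
  by have := leq_trunc_div t 12; rewrite -/q; lia.
apply: leq_ltn_trans (_ : C * 12 ^ 6 * 2 ^ t < _)%N; first by rewrite -mulnA leq_mul2l h1 orbT.
rewrite -[8%N]/(4 * 2)%N expnMn ltn_pmul2r ?expn_gt0 //.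
exact: leq_ltn_trans Ct (ltn_expl _ _).
Qed.

(** [L] is the binary logarithm of [p], rounded down. The terms [L / r] and [L / (2 r)] of the
    exponent pay for the logarithmic losses and for the length of the runs. *)
Lemma two_points_in_box_log (r : nat) : (24 <= r)%N -> ~~ odd r ->
  exists L0, forall (p : nat) (a c : int) (H L : nat),
  prime p -> (3 < p)%N -> coprime `|a| p ->
  (2 ^ L <= p < 2 ^ L.+1)%N -> (L0 <= L)%N ->
  (2 ^ (L %/ 6 + L %/ r + L %/ (2 * r) + r + 5) < H)%N ->
  exists X Y : nat, (X <= p - 1)%N /\ (Y <= p - 1)%N /\
    (2 <= #|curveC p a c :&: boxB p X%:Z Y%:Z H|)%N.
Proof.
move=> r24 evr; have [t0 ht0] := poly_lt_exp (8 * (87 * r + 40) * r ^ 6).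
exists (r * t0.+1 + 8 * r + 100)%N => p a c H L pp p3 ap /andP[pL pL1] hL hH.
have r0 : (0 < r)%N by apply: leq_trans r24.
have rL : (8 * r + 100 <= L)%N by apply: leq_trans hL; rewrite -addnA leq_addl.
set t := (L %/ r)%N in hH; set q := (L %/ (2 * r))%N in hH.
(* [m = 2 ^ l] is of order [sqrt p]. The excess [t] of [n] over [L / 6] gives a factor [8 ^ t] that
   beats [n ^ 6]. With [w = 2 ^ q.+1], the value [V = r * w] ensures ['C(V, r) >= w ^ r >= m]. *)
pose l := (L %/ 2 - 1)%N; pose m := (2 ^ l)%N; pose n := (L %/ 6 + 1 + t)%N.
pose V := (r * 2 ^ q.+1)%N.
have tL : (t <= L %/ 24)%N by apply: leq_div2l.
have qL : (q <= L %/ 48)%N by apply: leq_div2l; rewrite // (leq_mul (leqnn 2) r24).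
have tt0 : (t0 <= t)%N.
  by rewrite leq_divRL // mulnC; apply: leq_trans hL; rewrite mulnS; move: (r * t0)%N; clear; lia.
have Lt : (L < r * t.+1)%N by rewrite mulnC -ltn_divLR.
have Lq : (L < 2 * (q.+1 * r))%N.
  by rewrite [(q.+1 * r)%N]mulnC mulnA mulnC -ltn_divLR // muln_gt0.
have r2 : (r <= 2 ^ r)%N by apply/ltnW/ltn_expl.
clearbody t q; have [l0 lL Ll rqL nL] :
    [/\ 0 < l, 2 + l * 2 <= L, L < 4 + l * 2, r + q.+1 < L & 5 + n * 4 < L]%N.
  by move: rL tL qL; rewrite /l /n; clear; split; lia.
have [n3 nL' lq] : [/\ 2 + l + 3 * t <= 3 * n, n <= L & l <= q.+1 * r]%N.
  by move: rL tL Lq; rewrite /l /n; move: (q.+1 * r)%N; clear; split; lia.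
have nr : (n <= r * t.+1)%N by apply: leq_trans (ltnW Lt).
have big : (32 * n ^ 6 * (m * (87 * r + 40)) < 2 ^ (3 * n))%N.
  have h1 : (4 * m * 8 ^ t <= 2 ^ (3 * n))%N.
    by rewrite -[4%N]/(2 ^ 2)%N -[8%N]/(2 ^ 3)%N /m -expnM -!expnD leq_exp2l.
  apply: leq_trans h1.
  have m0 : (0 < 4 * m)%N by rewrite muln_gt0 expn_gt0.
  have h2 : (n ^ 6 <= r ^ 6 * t.+1 ^ 6)%N by rewrite -expnMn leq_exp2r.
  move: (ht0 t tt0); rewrite -(ltn_pmul2l m0); apply: leq_ltn_trans.
  have := leq_mul (leqnn (32 * (m * (87 * r + 40)))) h2.
  by move: (r ^ 6)%N (t.+1 ^ 6)%N (n ^ 6)%N; clear; nia.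
have n12 : (12 * n ^ 2 <= 2 ^ n)%N.
  rewrite -(leq_exp2r _ _ (isT : 0 < 3)%N) -expnM mulnC [(n * 3)%N]mulnC.
  apply: leq_trans (ltnW big); rewrite expnMn -expnM.
  have : (54 <= m * (87 * r + 40))%N.
    by rewrite -[54%N]mul1n leq_mul ?expn_gt0 //; move: r24; clear; lia.
  by move: (n ^ (2 * 3))%N (m * _)%N; clear; nia.
apply: (@two_points_in_box p a c H n m V r) => //.
- by rewrite -{1}(expn0 2) ltn_exp2l.
- by apply: leq_trans pL; rewrite -[4%N]/(2 ^ 2)%N /m -expnM -expnD leq_exp2l.
- by apply: leq_trans (ltnW pL1) _; rewrite -[16%N]/(2 ^ 4)%N /m -expnM -expnD leq_exp2l.
- apply: leq_trans pL; apply: leq_ltn_trans (_ : 2 ^ (r + q.+1) < _)%N.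
    by rewrite expnD leq_mul2r r2 orbT.
  by rewrite ltn_exp2l.
- by apply: leq_trans (expn_leq_bin _ _); rewrite /m -expnM leq_exp2l.
- apply: leq_trans pL; apply: leq_trans (_ : 2 ^ (r + 4) <= _)%N.
    by rewrite expnD; move: (2 ^ r)%N r2 r24; clear; lia.
  by rewrite leq_exp2l //; move: rL; clear; lia.
- by rewrite /n addn1.
- apply: leq_trans pL; apply: leq_ltn_trans (_ : 2 ^ (5 + n * 4) < _)%N.
    by rewrite expnD -expnM leq_mul2r orbT.
  by rewrite ltn_exp2l.
apply: leq_ltn_trans hH.
apply: leq_trans (_ : 2 ^ n * (2 ^ (q + r + 4)) <= _)%N; last first.
  by rewrite -expnD leq_exp2l // /n; clear; lia.
rewrite leq_mul2l; apply/orP; right.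
rewrite /V !expnD (expnS _ q); move: (expn_gt0 2 q) r2; move: (2 ^ q)%N (2 ^ r)%N => x y /= x0 ry.
have : (x * r <= x * y)%N by rewrite leq_mul2l ry orbT.
have : (0 < r * x)%N by rewrite muln_gt0 r0.
by clear; nia.
Qed.

Lemma two_points_in_full_box (p : nat) (a c : int) (H : nat) :
  prime p -> (3 < p)%N -> (p <= H)%N ->
  exists X Y : nat, (X <= p - 1)%N /\ (Y <= p - 1)%N /\
    (2 <= #|curveC p a c :&: boxB p X%:Z Y%:Z H|)%N.
Proof.
move=> pp p3 pH; exists 0%N, 0%N; do 2!split=> //.
(* Offsets start at [1], so the residue [0] is represented by [p]. *)
pose P := curve_point a c pp; pose rep (y : 'F_p) := (y + p * (y == 0%R))%N.
have rep_box y : (0 < rep y <= H)%N /\ y = 0%:R + (rep y)%:R.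
  rewrite /rep natrD natrM natr_Zp (pchar_Fp_0 pp) mul0r addr0 add0r; split=> //.
  have [->|y0] := eqVneq y 0; first by rewrite muln1 add0n pH prime_gt0.
  rewrite muln0 addn0 (leq_trans (ltnW (ltn_Fp pp y)) pH) andbT lt0n.
  by apply: contra y0 => /eqP e; apply/eqP/ord_inj.
have inBox y : P y \in boxB p 0%N%:Z 0%N%:Z H.
  have [h1 e1] := rep_box y; have [h2 e2] := rep_box (cubic a c y).
  exact: (curve_point_box pp h1 h2 e1 e2).
have neq : P 0 != P 1 by apply/eqP => -[/eqP].
have <- : #|[set P 0; P 1]| = 2%N by rewrite cards2 neq.
apply: subset_leq_card; apply/subsetP => Q; rewrite in_set2 => /orP[] /eqP ->;
  by rewrite in_setI curve_point_in inBox.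
Qed.

(* Passage to real exponents *)
Local Close Scope ring_scope.
From Stdlib Require Import Reals Lra.

Lemma INR_expn (k : nat) : INR (expn 2 k) = pow 2 k.
Proof. by elim: k => // k IH; rewrite expnS -multE mult_INR IH. Qed.

Lemma leq_INR (m n : nat) : (m <= n)%N -> (INR m <= INR n)%R.
Proof. by move=> /ssrnat.leP; apply: le_INR. Qed.

Lemma INR_divn_mul (m d : nat) : (INR (m %/ d) * INR d <= INR m)%R.
Proof. by rewrite -mult_INR; apply: leq_INR; apply: leq_trunc_div. Qed.

Theorem theorem2 :
  forall eps : R, (0 < eps)%R ->
  exists Ceps : R, (0 < Ceps)%R /\
  forall (p : nat) (a c : int) (H : nat),
    prime p -> (3 < p)%N -> coprime (absz a) p ->
    (0 < H)%N ->
    (Ceps * Rpower (INR p) (1 / 6 + eps) <= INR H)%R ->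
    exists X Y : nat, (X <= p - 1)%N /\ (Y <= p - 1)%N /\
      (2 <= #|curveC p a c :&: boxB p X%:Z Y%:Z H|)%N.
Proof.
move=> eps eps0; have [k hk] := INR_unbounded (/ eps).
(* This gives [r * eps > 2], so the losses [3 L / (2 r)] in the exponent stay below [eps * L]. *)
pose r := (2 * (k + 12))%N.
have r24 : (24 <= r)%N by rewrite /r; clear; lia.
have evr : ~~ odd r by rewrite oddM.
have [L0 hL0] := two_points_in_box_log r24 evr.
(* The margin in [eps * L] is at least [L / (2 r)], which covers the constant [r + 6] once
   [L >= 2 * r * (r + 6)]. For smaller [p] the constant [2 ^ L1] already forces [H > p]. *)
pose L1 := (L0 + 2 * r * (r + 6)).+1.
exists (pow 2 L1); split; first by apply: pow_lt; lra.
move=> p a c H pp p3 ap _ hH.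
have [pH|Hp] := leqP p H; first exact: two_points_in_full_box.
have p0 : (1 < p)%N by apply: ltn_trans p3.
pose L := trunc_log 2 p.
have hL : (expn 2 L <= p < expn 2 L.+1)%N by apply: trunc_log_bounds => //; apply: ltn_trans p0.
have pR : (1 < INR p)%R by apply: (lt_INR 1); apply/ssrnat.ltP.
have ex0 : (0 < 1 / 6 + eps)%R by lra.
have pw1 : (1 < Rpower (INR p) (1 / 6 + eps))%R.
  by have := Rpower_lt (INR p) 0 (1 / 6 + eps) pR ex0; rewrite Rpower_O; [|lra].
have C1 : (0 < pow 2 L1)%R by apply: pow_lt; lra.
have L1L : (L1 <= L)%N.
  rewrite leqNgt; apply/negP => LL1.
  have : (INR p <= pow 2 L1)%R.
    rewrite -INR_expn; apply: leq_INR; case/andP: hL => _ /ltnW /leq_trans; apply.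
    by rewrite leq_exp2l.
  have : (INR H < INR p)%R by apply: lt_INR; apply/ssrnat.ltP.
  nra.
apply: (hL0 p a c H L) => //; first by apply: leq_trans L1L; rewrite /L1; clear; lia.
set E := (L %/ 6 + L %/ r + L %/ (2 * r) + r + 5)%N.
have rR : (0 < INR r)%R by apply: (lt_INR 0); apply/ssrnat.ltP; apply: leq_trans r24.
have reps : (2 < INR r * eps)%R.
  have : (INR r = 2 * (INR k + 12))%R by rewrite /r -multE mult_INR -plusE plus_INR /=; lra.
  have := Rinv_l eps; have := Rmult_lt_compat_r _ _ _ eps0 hk; nra.
have hE : (INR E.+1 <= INR L * (1 / 6 + eps))%R.
  have d6 := INR_divn_mul L 6; have dr := INR_divn_mul L r.
  have d2 := INR_divn_mul L (2 * r); have hr := leq_INR L1L.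
  have i6 : INR 6 = 6%R by rewrite /=; lra.
  have i2r : INR (2 * r) = (2 * INR r)%R by rewrite -multE mult_INR.
  have iL1 : (2 * INR r * (INR r + 6) <= INR L1)%R.
    rewrite -i2r -i6 -plus_INR -mult_INR plusE multE.
    by apply: leq_INR; apply: leqW; apply: leq_addl.
  have iE : INR E.+1 = (INR (L %/ 6) + INR (L %/ r) + INR (L %/ (2 * r)) + INR r + 6)%R.
    by rewrite S_INR /E -!plusE !plus_INR /=; lra.
  rewrite i6 in d6; rewrite i2r in d2; rewrite iE.
  have L0R := pos_INR L.
  apply: (Rmult_le_reg_r (INR r)) => //.
  move: rR reps d6 dr d2 hr iL1 L0R; clear.
  move: (INR r) (INR L) (INR L1) (INR (L %/ 6)) => R l l1 x.
  move: (INR _) (INR _) => y z; nra.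
apply/ssrnat.ltP; apply: INR_lt; apply: Rlt_le_trans hH.
rewrite INR_expn.
have : (pow 2 E.+1 <= Rpower (INR p) (1 / 6 + eps))%R.
  rewrite -Rpower_pow; last lra.
  apply: Rle_trans (_ : Rpower 2 (INR L * (1 / 6 + eps)) <= _)%R.
    by apply: Rle_Rpower => //; lra.
  rewrite -Rpower_mult Rpower_pow; last lra.
  apply: Rle_Rpower_l; first lra; split; first by apply: pow_lt; lra.
  by rewrite -INR_expn; apply: leq_INR; case/andP: hL.
have C1' : (1 <= pow 2 L1)%R by apply: pow_R1_Rle; lra.
have : (0 < pow 2 E)%R by apply: pow_lt; lra.
(* The spare factor [2] makes the inequality [2 ^ E < H] strict. *)
have -> : pow 2 E.+1 = (2 * pow 2 E)%R by [].
by move: C1'; move: (pow 2 E) (pow 2 L1) (Rpower _ _); clear => x y z; nra.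
Qed.
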